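(* Let $\Lambda$ be a rectilinear subset of $\mathbb Z^d$, let $T_{L,d}$ be the $d$-dimensional torus of side length $L$, and let $T$ be a tree on $n$ vertices with maximum degree $d_{\max}$ and depth $c\log n$. Then the mixing times of the Swendsen-Wang algorithm for the $q$-state Potts model at inverse temperature $\beta$ satisfy $$\tau(P^{\mathrm{SW}}_{\Lambda})\le e^{45\beta |A(\Lambda)|}\bigl(2+(\log 2+d\beta)|\Lambda|\bigr),$$ $$\tau(P^{\mathrm{SW}}_{T_{L,d}})\le e^{75\beta L^{d-1}}\bigl(2+(\log 2+d\beta)L^d\bigr),$$ $$\tau(P^{\mathrm{SW}}_{T})\le n^{5c\beta d_{\max}}\bigl(2+(\log 2+\beta)n\bigr).$$ Here $A(\Lambda)$ (also written $|A(\Lambda)|$ in the first bound) is the volume of $\Lambda$ divided by the minimal side length.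
   Context: Here $\beta>0$ and $q$ is a positive integer. A rectilinear subset of $\mathbb Z^d$ with side lengths $L_1,\dots,L_d$ is a translate of the box $\{1,\dots,L_1\}\times\dots\times\{1,\dots,L_d\}$, with the nearest-neighbour graph structure; its volume is its number of points $|\Lambda|$. $T_{L,d}$ is the discrete torus with vertex set $(\mathbb Z/L\mathbb Z)^d$ and nearest-neighbour edges. The tree $T$ is rooted, and its depth is the maximal distance of a vertex from the root. Swendsen-Wang chain $P_G^{\mathrm{SW}}$ on a finite graph $G=(V,E)$: the state space is $[q]^V$, $[q]=\{1,\dots,q\}$. From $\sigma$, let $E(\sigma)=\{xy\in E:\sigma_x=\sigma_y\}$; delete each edge of $E(\sigma)$ independently with probability $e^{-\beta}$, obtaining a random set $A\subset E(\sigma)$; then for each connected component of $(V,A)$ (isolated vertices included) choose independently a spin uniformly from $[q]$ and assign it to all vertices of the component. Its stationary distribution is the Potts measure $\mu_G(\sigma)\propto e^{-\beta H_G(\sigma)}$ with $H_G(\sigma)=\sum_{xy\in E}(1-\delta(\sigma_x,\sigma_y))$, where $\delta$ is the Kronecker delta. Mixing time: for an irreducible chain with transition matrix $P$ on a finite set $\Omega$ and stationary distribution $\mu$, $\tau(P)=\min\{t: d(t)\le \frac1{2e}\}$, where $d(t)=\max_{\sigma\in\Omega}\max_{A\subset\Omega}|\mu(A)-\sum_{\sigma'\in A}P^t(\sigma,\sigma')|$. *)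

(* Defs.v *)
From mathcomp Require Import all_boot all_order all_algebra finmap.
From mathcomp Require Import boolp classical_sets reals ereal sequences exp.

Set Implicit Arguments.
Unset Strict Implicit.
Unset Printing Implicit Defensive.

Import Order.TTheory GRing.Theory Num.Theory.
Local Open Scope ring_scope.

Section MarkovChain.
Variables (R : realType) (T : finType).

Fixpoint kernel_pow (P : T -> T -> R) (t : nat) (x y : T) : R :=
  if t is s.+1 then \sum_z P x z * kernel_pow P s z y else (x == y)%:R.

(* The quantities being maximised are nonnegative, so that the default value 0
   of the iterated maxima is harmless. *)
Definition tv_dist (P : T -> T -> R) (mu : T -> R) (t : nat) : R :=
  \big[Num.max/0]_(x : T) \big[Num.max/0]_(A : {set T})
    `| \sum_(y in A) mu y - \sum_(y in A) kernel_pow P t x y |.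

(* The infimum is a minimum when some t qualifies, and is +oo otherwise; hence
   a finite upper bound on [mixing_time] includes the existence of such a t. *)
Definition mixing_time (P : T -> T -> R) (mu : T -> R) : \bar R :=
  ereal_inf [set (t%:R)%:E | t in
    [set t : nat | tv_dist P mu t <= (2 * expR 1)^-1]]%classic.

End MarkovChain.

(* A finite simple graph is a symmetric irreflexive relation e on V; [edges]
   consists of its edges as two-element sets of vertices. *)
Section Graph.
Variables (V : finType) (e : rel V).

Definition edges : {set {set V}} :=
  [set [set p.1; p.2] | p in [set p : V * V | e p.1 p.2]].

Definition components (A : {set {set V}}) : {set {set V}} :=
  equivalence_partition (connect [rel x y | [set x; y] \in A]) [set: V].

Definition max_degree : nat := \max_(x : V) #|[set y | e x y]|.

(* A shortest walk has length less than #|V|; the value is #|V| when y is not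
   reachable from x. *)
Definition graph_dist (x y : V) : nat :=
  find (fun k => [exists p : k.-tuple V, path e x p && (last x p == y)])
    (iota 0 #|V|).

Definition depth (root : V) : nat := \max_(x : V) graph_dist root x.

Definition is_tree : Prop :=
  [/\ symmetric e, irreflexive e, forall x y, connect e x y
    & forall s : seq V, ucycle e s -> (size s <= 2)%N].

End Graph.

Section SwendsenWang.
Variables (R : realType) (beta : R) (q : nat) (V : finType) (e : rel V).

Definition config := {ffun V -> 'I_q}.

Definition monochromatic (s : config) (C : {set V}) : bool :=
  [forall x in C, forall y in C, s x == s y].

Definition mono_edges (s : config) : {set {set V}} :=
  [set f in edges e | monochromatic s f].

Definition hamiltonian (s : config) : R :=
  \sum_(f in edges e) (1 - (monochromatic s f)%:R).

Definition potts (s : config) : R :=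
  expR (- beta * hamiltonian s) /
  \sum_(s' : config) expR (- beta * hamiltonian s').

Definition bond_prob (s : config) (A : {set {set V}}) : R :=
  \prod_(f in mono_edges s) (if f \in A then 1 - expR (- beta) else expR (- beta)).

(* Probability that independent uniform spins, one for each component of
   (V, A), produce the configuration s. *)
Definition recolor_prob (A : {set {set V}}) (s : config) : R :=
  \prod_(C in components A) (if monochromatic s C then q%:R^-1 else 0).

Definition SW (s s' : config) : R :=
  \sum_(A : {set {set V}} | A \subset mono_edges s)
    bond_prob s A * recolor_prob A s'.

Definition SW_mixing_time : \bar R := mixing_time SW potts.

End SwendsenWang.

Section Lattice.
Variable d : nat.

Definition Zd_adj (x y : {ffun 'I_d -> int}) : bool :=
  \sum_i `|x i - y i| == 1.

Definition rectilinear (l : 'I_d -> nat) (Lam : {fset {ffun 'I_d -> int}}) :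
    Prop :=
  (forall i, (0 < l i)%N) /\
  exists a : {ffun 'I_d -> int}, forall x,
    (x \in Lam) = [forall i, 1 <= x i - a i <= (l i)%:Z].

Definition box_adj (Lam : {fset {ffun 'I_d -> int}}) : rel Lam :=
  fun x y => Zd_adj (val x) (val y).

(* When d > 0 and all l i > 0, each l i is at most the product, so that the
   default value does not affect the minimum. *)
Definition min_side (l : 'I_d -> nat) : nat :=
  \big[minn/(\prod_i l i)%N]_(i < d) l i.

Definition box_area (R : realType) (l : 'I_d -> nat)
    (Lam : {fset {ffun 'I_d -> int}}) : R :=
  (#|` Lam|)%:R / (min_side l)%:R.

(* [ordS] is the cyclic successor, so 'I_L plays the role of Z/LZ for L > 0.
   The graph is simple: there are no loops for L = 1 and no double edges for
   L = 2. *)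
Definition torus_adj (L : nat) : rel {ffun 'I_d -> 'I_L} :=
  fun x y => (x != y) &&
    [exists i, ((y i == ordS (x i)) || (x i == ordS (y i))) &&
               [forall j, (j != i) ==> (x j == y j)]].

End Lattice.

(* Main.v *)
Require Import Defs.
From mathcomp Require Import all_boot all_order all_algebra finmap.
From mathcomp Require Import boolp classical_sets reals ereal sequences exp.
From mathcomp Require Import fintype finset zify ring lra.

(** Give an edge set F the weight nu_F(s, A) of the Edwards-Sokal coupling of a
    Potts configuration s with a bond configuration A. Then SW is the two-step
    chain s -> A -> s', and its spectral gap is the Poincare constant in
    gap * Var f <= E Var(f | A).

    Unnormalised variances are monotone in the weight. Hence deleting the edges D
    costs at most a factor exp(- beta |D|) in the gap, the gap of a disjoint union
    is at least the minimum of the gaps, and forests have gap at least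
    exp(- beta). Recursive bisection of a d-dimensional box (d >= 2) along
    hyperplanes costs a geometric series of cuts, at most 21 |A(Lambda)| edges in
    total, and 36 L^(d-1) on the torus.

    The bound of the theorem does not depend on q, while the smallest
    probability of a configuration does. For at most 20 vertices the Doeblin
    condition P(s, s') >= exp(- beta |F|) / q^n is enough. For more vertices the
    chain is first run for about exp(beta Delta) (log n + 4) steps, Delta being a
    bound on the degrees: a vertex covered by a bond becomes isolated with
    probability at least exp(- beta Delta), an isolated one becomes covered with
    probability at most beta Delta / q, so few vertices remain covered. Given a
    bond configuration with k covered vertices, the density of the next
    configuration is at most q^k exp(beta |F|), which makes the L2 bound
    independent of q. *)

Set Implicit Arguments.
Unset Strict Implicit.
Unset Printing Implicit Defensive.

Import Order.TTheory GRing.Theory Num.Theory.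
Local Open Scope ring_scope.


(** Edge sets vary while the vertex type stays fixed, so deleting edges or splitting a graph only
    changes a weight on the same configurations; normalising constants, which would change too, stay
    out of the Poincare inequality. A bridge is handled by rotating the colours on one side: the
    colour difference across it becomes an independent variable, and the coupling a product with a
    one-edge model of gap at least exp(- beta).

    Independence of q comes from a cutoff j. For bond configurations whose number k of covered
    vertices satisfies k ln q <= j, the L2 bound loses at most exp((beta |F| + j) / 2); the others
    cost at most min(1, ln q / j) per covered vertex. After the burn-in the expected number of
    covered vertices is at most n beta Delta exp(beta Delta) / q, up to a small term, so q survives
    only through ln q / q <= 1/e, and a cutoff of order n exp(9 beta Delta) fits into the time
    allowed. *)

Section WeightedVariance.
Variable R : realType.
Implicit Types X Y : finType.

(** This is the minimum over [c] of the [u]-weighted sum of [(f - c) ^+ 2]. If [u >= 0] has mass 0,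
    division by 0 gives the correct value 0, so null fibres of a coupling need no separate
    treatment. *)
Definition wvar X (u f : X -> R) : R :=
  \sum_x u x * f x ^+ 2 - (\sum_x u x * f x) ^+ 2 / \sum_x u x.

Definition wmean X (u f : X -> R) : R := (\sum_x u x * f x) / \sum_x u x.

Lemma wsum_eq0 X (u f : X -> R) :
  (forall x, 0 <= u x) -> \sum_x u x = 0 -> \sum_x u x * f x = 0.
Proof.
move=> u0 /eqP; rewrite psumr_eq0 => [/allP H|x _]; last exact: u0.
rewrite big1 // => x _.
by have /eqP -> := H x (mem_index_enum x); rewrite mul0r.
Qed.

Lemma mulr_wmean X (u f : X -> R) : (forall x, 0 <= u x) ->
  (\sum_x u x) * wmean u f = \sum_x u x * f x.
Proof.
move=> u0; rewrite /wmean; have [e|ne] := eqVneq (\sum_x u x) 0.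
  by rewrite (wsum_eq0 f u0 e) e mul0r.
by field.
Qed.

Lemma wvar_shift X (u f : X -> R) (c : R) : (forall x, 0 <= u x) ->
  \sum_x u x * (f x - c) ^+ 2 =
  wvar u f + (\sum_x u x) * (wmean u f - c) ^+ 2.
Proof.
move=> u0.
have -> : \sum_x u x * (f x - c) ^+ 2 = \sum_x u x * f x ^+ 2
    - 2 * c * (\sum_x u x * f x) + c ^+ 2 * (\sum_x u x).
  rewrite !mulr_sumr -sumrB -big_split /=; apply: eq_bigr => x _; ring.
rewrite /wvar /wmean; have [e|ne] := eqVneq (\sum_x u x) 0.
  by rewrite (wsum_eq0 f u0 e) e !(mul0r, mulr0, expr0n, subr0, addr0).
by field.
Qed.

Lemma wvarE X (u f : X -> R) : (forall x, 0 <= u x) ->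
  wvar u f = \sum_x u x * (f x - wmean u f) ^+ 2.
Proof. by move=> u0; rewrite wvar_shift // subrr expr0n mulr0 addr0. Qed.

Lemma wvar_ge0 X (u f : X -> R) : (forall x, 0 <= u x) -> 0 <= wvar u f.
Proof.
by move=> u0; rewrite wvarE //; apply: sumr_ge0 => x _; rewrite mulr_ge0 ?sqr_ge0.
Qed.

Lemma wvar_le X (u f : X -> R) (c : R) : (forall x, 0 <= u x) ->
  wvar u f <= \sum_x u x * (f x - c) ^+ 2.
Proof.
move=> u0; rewrite wvar_shift // lerDl mulr_ge0 ?sqr_ge0 //.
by apply: sumr_ge0.
Qed.

Lemma wvar_mono X (u v f : X -> R) : (forall x, 0 <= u x <= v x) ->
  wvar u f <= wvar v f.
Proof.
move=> uv; have u0 x : 0 <= u x by case/andP: (uv x).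
have v0 x : 0 <= v x by case/andP: (uv x) => ?; apply: le_trans.
rewrite (wvarE f v0); apply: (le_trans (wvar_le f (wmean v f) u0)).
by apply: ler_sum => x _; rewrite ler_wpM2r ?sqr_ge0 //; case/andP: (uv x).
Qed.

Lemma wvarZ X (u f : X -> R) (a : R) : wvar (fun x => a * u x) f = a * wvar u f.
Proof.
rewrite /wvar mulrBr.
have -> : \sum_x a * u x * f x ^+ 2 = a * (\sum_x u x * f x ^+ 2).
  by rewrite mulr_sumr; apply: eq_bigr => x _; rewrite mulrA.
have -> : \sum_x a * u x * f x = a * (\sum_x u x * f x).
  by rewrite mulr_sumr; apply: eq_bigr => x _; rewrite mulrA.
rewrite -mulr_sumr; congr (_ - _); rewrite invfM exprMn.
have [->|a0] := eqVneq a 0; first by rewrite expr0n !mul0r.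
by set i := (\sum_x u x)^-1; field.
Qed.

Lemma eq_wvar X (u v f g : X -> R) : u =1 v -> f =1 g -> wvar u f = wvar v g.
Proof.
move=> uv fg; rewrite /wvar; congr (_ - _ ^+ 2 / _);
  by apply: eq_bigr => x _; rewrite ?uv ?fg.
Qed.

Lemma wvar_pushforward X X' (phi : X' -> X) (N : R) (u f : X -> R) : 0 < N ->
  (forall h : X -> R, \sum_x h (phi x) = N * \sum_x h x) ->
  wvar (u \o phi) (f \o phi) = N * wvar u f.
Proof.
move=> N0 HN; rewrite /wvar /=.
rewrite (HN u) (HN (fun x => u x * f x)) (HN (fun x => u x * f x ^+ 2)) mulrBr.
congr (_ - _); rewrite invfM exprMn; set i := (\sum_x u x)^-1; field; exact: lt0r_neq0.
Qed.

Lemma cauchy_schwarz_sum X (g a b : X -> R) : (forall x, 0 <= g x) ->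
  (\sum_x g x * (a x * b x)) ^+ 2 <=
  (\sum_x g x * a x ^+ 2) * (\sum_x g x * b x ^+ 2).
Proof.
move=> g0; set A := \sum_x g x * a x ^+ 2; set B := \sum_x g x * b x ^+ 2.
set C := \sum_x _.
have A0 : 0 <= A by apply: sumr_ge0 => x _; rewrite mulr_ge0 ?sqr_ge0.
have B0 : 0 <= B by apply: sumr_ge0 => x _; rewrite mulr_ge0 ?sqr_ge0.
have H (s : R) : 0 <= A + 2 * s * C + s ^+ 2 * B.
  have -> : A + 2 * s * C + s ^+ 2 * B = \sum_x g x * (a x + s * b x) ^+ 2.
    rewrite /A /B /C !mulr_sumr -!big_split /=; apply: eq_bigr => x _; ring.
  by apply: sumr_ge0 => x _; rewrite mulr_ge0 ?sqr_ge0.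
have [B00|Bn0] := eqVneq B 0.
  rewrite B00 mulr0; have [->|C0] := eqVneq C 0; first by rewrite expr0n.
  (* For [B = 0] the form is affine in [s]; this [s] would give it the value -1. *)
  have := H (- (A + 1) / (2 * C)); rewrite B00 mulr0 addr0.
  have -> : 2 * (- (A + 1) / (2 * C)) * C = - (A + 1) by field.
  lra.
have := H (- C / B).
have -> : A + 2 * (- C / B) * C + (- C / B) ^+ 2 * B = (A * B - C ^+ 2) / B by field.
by rewrite pmulr_lge0 ?invr_gt0 ?lt0r ?Bn0 // subr_ge0.
Qed.

Lemma jensen_sqr X (g a : X -> R) : (forall x, 0 <= g x) ->
  (\sum_x g x * a x) ^+ 2 <= (\sum_x g x) * (\sum_x g x * a x ^+ 2).
Proof.
move=> g0; have := cauchy_schwarz_sum (fun=> 1) a g0.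
under eq_bigr do rewrite mul1r.
by under [X in _ <= X * _]eq_bigr do rewrite expr1n mulr1.
Qed.

(** Convexity of the variance in the function: each [f y] is centred at its own mean, the average is
    centred at the average of these means, and Jensen is applied pointwise in [x]. *)
Lemma wvar_convex X Y (g : Y -> R) (u : X -> R) (f : Y -> X -> R) :
  (forall y, 0 <= g y) -> (forall x, 0 <= u x) -> 0 < \sum_y g y ->
  (\sum_y g y) * wvar u (fun x => wmean g (f^~ x)) <= \sum_y g y * wvar u (f y).
Proof.
move=> g0 u0 G0; set G := \sum_y g y.
pose c y := wmean u (f y).
have H : wvar u (fun x => wmean g (f^~ x)) <=
   \sum_x u x * (wmean g (fun y => f y x - c y)) ^+ 2.
  apply: le_trans (wvar_le _ (wmean g c) u0) _.
  rewrite le_eqVlt; apply/orP; left; apply/eqP; apply: eq_bigr => x _.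
  congr (_ * _ ^+ 2); rewrite /wmean -mulrBl; congr (_ / _).
  by rewrite -sumrB; apply: eq_bigr => y _; rewrite mulrBr.
apply: le_trans (ler_wpM2l (ltW G0) H) _.
under [X in _ <= X]eq_bigr => y _ do rewrite (wvarE (f y) u0) mulr_sumr.
rewrite exchange_big /= mulr_sumr; apply: ler_sum => x _.
have -> : \sum_y g y * (u x * (f y x - wmean u (f y)) ^+ 2) =
   u x * \sum_y g y * (f y x - c y) ^+ 2.
  by rewrite mulr_sumr; apply: eq_bigr => y _; rewrite mulrCA.
rewrite mulrCA ler_wpM2l //.
rewrite -(ler_pM2l G0) mulrA -expr2 -exprMn mulr_wmean //.
exact: jensen_sqr.
Qed.

(** Law of total variance for a product weight, conditioning on the second coordinate. *)
Lemma wvar_total X1 X2 (u1 : X1 -> R) (u2 : X2 -> R) (f : X1 * X2 -> R) :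
  wvar (fun z => u1 z.1 * u2 z.2) f =
  \sum_x2 u2 x2 * wvar u1 (fun x1 => f (x1, x2)) +
  (\sum_x1 u1 x1) * wvar u2 (fun x2 => wmean u1 (fun x1 => f (x1, x2))).
Proof.
have E (h : X1 * X2 -> R) : \sum_z u1 z.1 * u2 z.2 * h z =
    \sum_x2 u2 x2 * \sum_x1 u1 x1 * h (x1, x2).
  rewrite (reindex (fun z : X2 * X1 => (z.2, z.1))) /=; last first.
    by exists (fun z => (z.2, z.1)) => -[].
  rewrite -(pair_bigA _ (fun x2 x1 => u1 x1 * u2 x2 * h (x1, x2))) /=.
  apply: eq_bigr => x2 _; rewrite mulr_sumr; apply: eq_bigr => x1 _; ring.
have E1 : \sum_z u1 z.1 * u2 z.2 = (\sum_x1 u1 x1) * (\sum_x2 u2 x2).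
  have := E (fun=> 1); under eq_bigr do rewrite mulr1.
  move=> ->; rewrite mulrC mulr_suml; apply: eq_bigr => x2 _; congr (_ * _).
  by apply: eq_bigr => x1 _; rewrite mulr1.
rewrite /wvar (E (fun z => f z ^+ 2)) (E f) E1.
set m1 := \sum_x1 u1 x1; set m2 := \sum_x2 u2 x2.
under [X in _ = X + _]eq_bigr do rewrite mulrBr.
rewrite sumrB /wmean -/m1.
pose S x2 := \sum_x1 u1 x1 * f (x1, x2).
rewrite -[X in _ = _ + m1 * (X - _)]/(\sum_x u2 x * (S x / m1) ^+ 2).
rewrite -[X in _ = _ + m1 * (_ - X ^+ 2 / _)]/(\sum_x u2 x * (S x / m1)).
rewrite -[X in _ - X ^+ 2 / _ = _]/(\sum_x u2 x * S x).
rewrite -[X in _ = _ - X + _]/(\sum_i u2 i * (S i ^+ 2 / m1)).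
have -> : \sum_x u2 x * (S x / m1) = (\sum_x u2 x * S x) / m1.
  by rewrite mulr_suml; apply: eq_bigr => x _; rewrite mulrA.
have -> : \sum_x u2 x * (S x / m1) ^+ 2 = (\sum_i u2 i * (S i ^+ 2 / m1)) / m1.
  by rewrite mulr_suml; apply: eq_bigr => x _; rewrite expr2; ring.
set A := \sum_i u2 i * (S i ^+ 2 / m1); set B := \sum_x u2 x * S x.
have [m10|m10] := eqVneq m1 0; last first.
  by rewrite invfM; set i2 := m2^-1; field.
rewrite /A m10 !(invr0, mul0r, mulr0, subr0, addr0).
have -> : \sum_i u2 i * (S i ^+ 2 * 0) = 0 by apply: big1 => i _; rewrite !mulr0.
by rewrite subr0.
Qed.

End WeightedVariance.

(** * Poincare inequalities for couplings: comparison, products, images *)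

Section Poincare.
Variable R : realType.
Implicit Types X Y : finType.

Definition poincare X Y (nu : X -> Y -> R) (gap : R) : Prop :=
  forall f : X -> R,
    gap * wvar (fun x => \sum_y nu x y) f <= \sum_y wvar (nu^~ y) f.

Lemma poincare_weaken X Y (nu : X -> Y -> R) (a b : R) :
  (forall x y, 0 <= nu x y) -> b <= a -> poincare nu a -> poincare nu b.
Proof.
move=> nu0 ba Pa f; apply: le_trans (Pa f); rewrite ler_wpM2r // wvar_ge0 // => x.
exact: sumr_ge0.
Qed.

(** The fibre variances need only a lower bound on [nu], the total variance only an upper bound on
    its first marginal; [wvar_mono] gives both comparisons. *)
Lemma poincare_dominated X Y (nu nu' : X -> Y -> R) (a gap : R) : 0 <= a ->
  0 <= gap -> (forall x y, 0 <= nu' x y) ->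
  (forall x y, a * nu' x y <= nu x y) ->
  (forall x, \sum_y nu x y <= \sum_y nu' x y) ->
  poincare nu' gap -> poincare nu (a * gap).
Proof.
move=> a0 gap0 nu'0 anu' nunu' P f.
have nu0 x y : 0 <= nu x y by apply: le_trans (anu' x y); rewrite mulr_ge0.
apply: (@le_trans _ _ (\sum_y a * wvar (nu'^~ y) f)); last first.
  apply: ler_sum => y _; rewrite -wvarZ; apply: wvar_mono => x.
  by rewrite anu' mulr_ge0.
rewrite -mulr_sumr -mulrA ler_wpM2l //; apply: le_trans (P f).
by rewrite ler_wpM2l // wvar_mono // => x; rewrite nunu' sumr_ge0.
Qed.

(** Tensorisation. In the law of total variance the first term is bounded by [nu1] with [x2] fixed.
    In the second, the mean over [x1] is the [g1]-average over [y1] of the fibre means [fy], so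
    convexity reduces it to fixed [y1], where [nu2] applies. *)
Lemma poincare_prod X1 X2 Y1 Y2 (nu1 : X1 -> Y1 -> R) (nu2 : X2 -> Y2 -> R)
    (gap : R) :
  (forall x y, 0 <= nu1 x y) -> (forall x y, 0 <= nu2 x y) ->
  0 < \sum_x \sum_y nu1 x y -> poincare nu1 gap -> poincare nu2 gap ->
  0 <= gap -> poincare (fun x y => nu1 x.1 y.1 * nu2 x.2 y.2) gap.
Proof.
move=> n1 n2 m0 P1 P2 gap0 f.
pose w1 x := \sum_y nu1 x y; pose w2 x := \sum_y nu2 x y.
have w10 x : 0 <= w1 x by apply: sumr_ge0.
have w20 x : 0 <= w2 x by apply: sumr_ge0.
pose g1 y := \sum_x nu1 x y.
have g10 y : 0 <= g1 y by apply: sumr_ge0.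
have mE : \sum_y g1 y = \sum_x w1 x by rewrite exchange_big.
have -> : wvar (fun x => \sum_y nu1 x.1 y.1 * nu2 x.2 y.2) f =
    wvar (fun x => w1 x.1 * w2 x.2) f.
  apply: eq_wvar => // x; rewrite /w1 /w2 mulr_suml.
  rewrite -(pair_bigA _ (fun y1 y2 => nu1 x.1 y1 * nu2 x.2 y2)) /=.
  by apply: eq_bigr => y _; rewrite mulr_sumr.
rewrite wvar_total.
rewrite -(pair_bigA _ (fun y1 y2 => wvar (fun x => nu1 x.1 y1 * nu2 x.2 y2) f)) /=.
under [X in _ <= X]eq_bigr => y1 _ do under eq_bigr => y2 _ do
  rewrite (wvar_total (nu1^~ y1) (nu2^~ y2)).
under [X in _ <= X]eq_bigr => y1 _ do rewrite big_split /=.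
rewrite big_split /= mulrDr; apply: lerD.
  have -> : \sum_y1 \sum_y2 \sum_x2 nu2 x2 y2 * wvar (nu1^~ y1) (fun x => f (x, x2))
    = \sum_x2 w2 x2 * \sum_y1 wvar (nu1^~ y1) (fun x => f (x, x2)).
    under eq_bigr => y1 _ do rewrite exchange_big.
    rewrite exchange_big /=; apply: eq_bigr => x2 _; rewrite mulr_sumr.
    by apply: eq_bigr => y1 _; rewrite mulr_suml.
  rewrite mulr_sumr; apply: ler_sum => x2 _; rewrite mulrCA ler_wpM2l //.
pose fy y1 x2 := wmean (nu1^~ y1) (fun x1 => f (x1, x2)).
apply: (@le_trans _ _ (\sum_y1 g1 y1 * (gap * wvar w2 (fy y1)))); last first.
  apply: ler_sum => y1 _; rewrite -mulr_sumr ler_wpM2l //; exact: P2.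
have -> : wvar w2 (fun x2 => wmean w1 (fun x1 => f (x1, x2))) =
    wvar w2 (fun x2 => wmean g1 (fy^~ x2)).
  apply: eq_wvar => // x2; rewrite /wmean mE; congr (_ / _).
  under [RHS]eq_bigr => y _ do rewrite /fy mulr_wmean //.
  by rewrite exchange_big /=; apply: eq_bigr => x _; rewrite mulr_suml.
have -> : \sum_y1 g1 y1 * (gap * wvar w2 (fy y1)) =
    gap * \sum_y1 g1 y1 * wvar w2 (fy y1).
  by rewrite mulr_sumr; apply: eq_bigr => y _; rewrite mulrCA.
rewrite ler_wpM2l // -mE wvar_convex // mE //.
Qed.

(* Each good [y'] represents the bond configuration [psi y'], and [phi] is
   [N]-to-one in the weak sense that it pushes the counting measure to [N]
   times the counting measure. *)
Lemma poincare_pushforward X Y X' Y' (nu : X -> Y -> R) (nu' : X' -> Y' -> R)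
    (phi : X' -> X) (psi : Y' -> Y) (good : pred Y') (N gap : R) : 0 < N ->
  (forall x y, 0 <= nu x y) ->
  (forall h : X -> R, \sum_x h (phi x) = N * \sum_x h x) ->
  {in good &, injective psi} ->
  (forall x y, nu' x y = if good y then nu (phi x) (psi y) else 0) ->
  (forall x, \sum_y nu' x y = \sum_y nu (phi x) y) ->
  poincare nu' gap -> poincare nu gap.
Proof.
move=> N0 nu0 HN inj nu'E marg P f; have := P (f \o phi).
have -> : wvar (fun x => \sum_y nu' x y) (f \o phi) =
    N * wvar (fun x => \sum_y nu x y) f.
  rewrite -(wvar_pushforward _ _ N0 HN); exact: eq_wvar.
have E y' : wvar (nu'^~ y') (f \o phi) =
    if good y' then N * wvar (nu^~ (psi y')) f else 0.
  case: ifP => gy.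
    rewrite -(wvar_pushforward _ _ N0 HN); apply: eq_wvar => // x.
    by rewrite nu'E gy.
  rewrite /wvar !big1 ?expr0n ?mul0r ?subr0 // => x _;
    by rewrite nu'E gy ?mul0r.
rewrite (eq_bigr _ (fun y _ => E y)) -big_mkcond -mulr_sumr mulrCA ler_pM2l //.
move/le_trans; apply.
(* By injectivity the good fibres are distinct fibres of [nu]; the remaining ones only add
   nonnegative terms. *)
rewrite -(big_imset (fun y => wvar (nu^~ y) f)) //=.
rewrite [X in _ <= X](bigID (mem (psi @: good))) /= lerDl.
by apply: sumr_ge0 => y _; apply: wvar_ge0.
Qed.

End Poincare.

(** * L2 contraction of a two-step chain *)

Section TwoStep.
Variables (R : realType) (X Y : finType) (nu : X -> Y -> R).
Hypothesis nu0 : forall x y, 0 <= nu x y.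

Let w x := \sum_y nu x y.
Let g y := \sum_x nu x y.

(** Conditional expectation given [y]; [up] is the one given [x]. They are adjoint for the marginals
    [w] and [g], and [up \o down] is the operator of the two-step chain. *)
Definition down (f : X -> R) (y : Y) : R := wmean (nu^~ y) f.
Definition up (h : Y -> R) (x : X) : R := wmean (nu x) h.

Let w0 x : 0 <= w x. Proof. exact: sumr_ge0. Qed.
Let g0 y : 0 <= g y. Proof. exact: sumr_ge0. Qed.

Lemma down_dual (f : X -> R) (h : Y -> R) :
  \sum_y g y * (down f y * h y) = \sum_x w x * (f x * up h x).
Proof.
transitivity (\sum_y \sum_x nu x y * f x * h y).
  by apply: eq_bigr => y _; rewrite mulrA mulr_wmean // mulr_suml.
rewrite exchange_big; apply: eq_bigr => x _; rewrite mulrCA mulr_wmean //.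
by rewrite mulr_sumr; apply: eq_bigr => y _; rewrite mulrCA mulrA.
Qed.

Lemma sum_down (f : X -> R) : \sum_y g y * down f y = \sum_x w x * f x.
Proof.
under eq_bigr => y _ do rewrite mulr_wmean //.
by rewrite exchange_big; apply: eq_bigr => x _; rewrite -mulr_suml.
Qed.

Lemma sum_up (h : Y -> R) : \sum_x w x * up h x = \sum_y g y * h y.
Proof.
under eq_bigr => x _ do rewrite mulr_wmean //.
by rewrite exchange_big; apply: eq_bigr => x _; rewrite -mulr_suml.
Qed.

(** The conditional variances add up to what [down] loses in squared L2 norm; this turns the
    Poincare inequality into a contraction. *)
Lemma wvar_down (f : X -> R) :
  \sum_y wvar (nu^~ y) f =
  \sum_x w x * f x ^+ 2 - \sum_y g y * down f y ^+ 2.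
Proof.
rewrite /wvar sumrB exchange_big; congr (_ - _).
  by apply: eq_bigr => x _; rewrite mulr_suml.
apply: eq_bigr => y _; rewrite expr2 [in RHS]expr2 mulrA mulr_wmean //.
by rewrite /down /wmean mulrA.
Qed.

Variable gap : R.
Hypotheses (gap_le1 : gap <= 1) (P : poincare nu gap).

Lemma down_contract (f : X -> R) : \sum_x w x * f x = 0 ->
  \sum_y g y * down f y ^+ 2 <= (1 - gap) * \sum_x w x * f x ^+ 2.
Proof.
move=> f0; have := P f; rewrite wvar_down /wvar -/(w _).
rewrite [X in _ - X ^+ 2 / _]f0 expr0n mul0r subr0; lra.
Qed.

(* The norm of [up] on mean-zero functions equals that of its adjoint [down]. *)
Lemma up_contract (h : Y -> R) : \sum_y g y * h y = 0 ->
  \sum_x w x * up h x ^+ 2 <= (1 - gap) * \sum_y g y * h y ^+ 2.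
Proof.
move=> h0; set S := \sum_x w x * up h x ^+ 2.
have S0 : 0 <= S by apply: sumr_ge0 => x _; rewrite mulr_ge0 ?sqr_ge0.
set G := \sum_y g y * h y ^+ 2.
have G0 : 0 <= G by apply: sumr_ge0 => x _; rewrite mulr_ge0 ?sqr_ge0.
have SE : S = \sum_y g y * (down (up h) y * h y).
  by rewrite down_dual; apply: eq_bigr => x _; rewrite expr2.
have D : \sum_y g y * down (up h) y ^+ 2 <= (1 - gap) * S.
  by apply: down_contract; rewrite sum_up.
have : S ^+ 2 <= (1 - gap) * S * G.
  rewrite {1}SE; apply: le_trans (cauchy_schwarz_sum _ _ g0) _.
  by rewrite ler_wpM2r.
have [-> _|Sn0] := eqVneq S 0; first by rewrite mulr_ge0 // subr_ge0.
by rewrite expr2 -mulrA mulrCA ler_pM2l // lt0r Sn0.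
Qed.

Lemma two_step_contract (f : X -> R) : \sum_x w x * f x = 0 ->
  \sum_x w x * up (down f) x ^+ 2 <= (1 - gap) ^+ 2 * \sum_x w x * f x ^+ 2.
Proof.
move=> f0; apply: le_trans (up_contract _) _; first by rewrite sum_down.
by rewrite expr2 -mulrA ler_wpM2l ?subr_ge0 // down_contract.
Qed.

Lemma two_step_contract_iter (f : X -> R) s : \sum_x w x * f x = 0 ->
  \sum_x w x * iter s (up \o down) f x = 0 /\
  \sum_x w x * iter s (up \o down) f x ^+ 2 <=
  (1 - gap) ^+ (2 * s) * \sum_x w x * f x ^+ 2.
Proof.
move=> f0; elim: s => [|s [IH1 IH2]]; first by rewrite muln0 expr0 mul1r.
split=> /=; first by rewrite sum_up sum_down.
apply: le_trans (two_step_contract IH1) _.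
by rewrite mulnS exprD -mulrA ler_wpM2l // sqr_ge0.
Qed.

End TwoStep.

(** * The Edwards-Sokal coupling and its Poincare constant *)

Section PoincareBasic.
Variables (R : realType) (X Y : finType) (nu : X -> Y -> R).

(** The fibre over [y0] carries the whole variance. This covers the empty edge set and the reference
    model of a single closed edge. *)
Lemma poincare_deterministic (y0 : Y) : (forall x y, 0 <= nu x y) ->
  (forall x, nu x y0 = \sum_y nu x y) -> poincare nu 1.
Proof.
move=> nu0 nuE f; rewrite mul1r (bigD1 y0) //=.
rewrite (@eq_wvar _ _ (fun x => \sum_y nu x y) (nu^~ y0) f f) //.
by rewrite lerDl; apply: sumr_ge0 => y _; apply: wvar_ge0.
Qed.

End PoincareBasic.

Section BondModel.
Variables (R : realType) (beta : R) (q' : nat) (V : finType).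
Hypothesis beta0 : 0 < beta.
Local Notation q := q'.+1.
Implicit Types (F A : {set {set V}}) (s t : config q V).

Lemma expRN_lt1 : expR (- beta) < 1 :> R.
Proof. by rewrite expR_lt1 oppr_lt0. Qed.

Local Notation r := (expR (- beta) : R).
Local Notation p := (1 - r).
Let r_gt0 : 0 < r. Proof. exact: expR_gt0. Qed.
Let p_gt0 : 0 < p. Proof. by rewrite subr_gt0 expRN_lt1. Qed.
Let r_ge0 := ltW r_gt0.
Let p_ge0 := ltW p_gt0.
Let r_le1 : r <= 1. Proof. exact/ltW/expRN_lt1. Qed.

(* The unnormalised Edwards-Sokal coupling of the Potts model and the random
   cluster model; the factor at [f \in A] vanishes unless [f \in F]. *)
Definition es_factor F A s (f : {set V}) : R :=
  if f \in A then (1 - expR (- beta)) * ((f \in F) && monochromatic s f)%:R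
  else if f \in F then expR (- beta) else 1.

Definition es F s A : R := \prod_f es_factor F A s f.

Definition es_gap F (gap : R) : Prop := poincare (es F) gap.

Definition weight F s : R :=
  \prod_(f in F) if monochromatic s f then 1 else expR (- beta).

Lemma es_factor_ge0 F A s f : 0 <= es_factor F A s f.
Proof.
by rewrite /es_factor; case: ifP => _; [rewrite mulr_ge0|case: ifP].
Qed.

Lemma es_ge0 F s A : 0 <= es F s A.
Proof. by apply: prodr_ge0 => f _; apply: es_factor_ge0. Qed.

Lemma sum_es F s : \sum_A es F s A = weight F s.
Proof.
rewrite /es /es_factor -bigA_distr /weight [RHS]big_mkcond.
apply: eq_bigr => f _; case: (f \in F) => /=; last by rewrite mulr0 add0r.
by case: monochromatic; rewrite ?mulr0 ?mulr1 ?add0r ?subrK.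
Qed.

Lemma weight_gt0 F s : 0 < weight F s.
Proof. by apply: prodr_gt0 => f _; case: ifP => _ //; exact: expR_gt0. Qed.

Lemma weight_le1 F s : weight F s <= 1.
Proof.
have -> : 1 = \prod_(f in F) (1 : R) by rewrite big1.
by apply: ler_prod => f _; case: ifP; rewrite ?lexx ?ler01 ?r_ge0 ?r_le1.
Qed.

Lemma weight_ge F s : expR (- beta) ^+ #|F| <= weight F s.
Proof.
rewrite -prodr_const; apply: ler_prod => f _; rewrite r_ge0 /=.
by case: ifP => _ //; apply: r_le1.
Qed.

Lemma es_set0 F s : es F s set0 = expR (- beta) ^+ #|F|.
Proof.
rewrite /es /es_factor -prodr_const [RHS]big_mkcond.
by apply: eq_bigr => f _; rewrite in_set0.
Qed.

Lemma es_gap_set0 : es_gap set0 1.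
Proof.
apply: (poincare_deterministic (y0 := set0)); first exact: es_ge0.
by move=> s; rewrite sum_es es_set0 /weight big_set0 cards0 expr0.
Qed.

Lemma es_gap_weaken F (a b : R) : b <= a -> es_gap F a -> es_gap F b.
Proof. by apply: poincare_weaken; apply: es_ge0. Qed.

(** The coupling of [F :\: D] gives weight 0 to an open edge of [D]; a closed one has factor 1 there
    and at least [expR (- beta)] in [es F]. The marginal [weight] only decreases when edges are
    added. *)
Lemma es_gap_delete F D (gap : R) : 0 <= gap ->
  es_gap (F :\: D) gap -> es_gap F (expR (- beta) ^+ #|D| * gap).
Proof.
move=> gap0; apply: poincare_dominated => //.
- by move=> s A; apply: es_ge0.
- move=> s A; rewrite -prodr_const big_mkcond -big_split /=.
  apply: ler_prod => f _; apply/andP; split.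
    by rewrite mulr_ge0 ?es_factor_ge0 //; case: ifP.
  rewrite /es_factor in_setD; case: (f \in A).
    case: (f \in D); first by rewrite /= mulr0 mulr0 mulr_ge0.
    by rewrite mul1r.
  by case: (f \in D) => /=; case: (f \in F); rewrite ?mulr1 ?mul1r.
- move=> s; rewrite !sum_es /weight [X in X <= _]big_mkcond.
  rewrite [X in _ <= X]big_mkcond /=; apply: ler_prod => f _.
  rewrite in_setD; case: (f \in F) => /=; last by rewrite andbF ler01 lexx.
  by case: (f \in D); case: monochromatic => /=;
    rewrite ?ler01 ?lexx ?r_ge0 ?r_le1.
Qed.

Definition merge (W : {set V}) s t : config q V :=
  [ffun x => if x \in W then s x else t x].

Lemma sum_merge (W : {set V}) (h : config q V -> R) :
  \sum_z h (merge W z.1 z.2) = #|{: config q V}|%:R * \sum_s h s.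
Proof.
(* Exchanging the two configurations off [W] is an involution with first component [merge]. *)
pose m (z : config q V * config q V) := (merge W z.1 z.2, merge W z.2 z.1).
have mK : involutive m.
  by move=> [s t]; congr (_, _); apply/ffunP => x; rewrite !ffunE; case: (x \in W).
rewrite (reindex m) /=; last by exists m => z _; apply: mK.
rewrite (eq_bigr (fun z : config q V * config q V => h z.1)); last first.
  move=> z _; congr h; exact: (congr1 fst (mK z)).
rewrite -(pair_bigA _ (fun s (t : config q V) => h s)) /= mulr_sumr.
by apply: eq_bigr => s _; rewrite sumr_const mulr_natl.
Qed.

Lemma card_config_gt0 : 0 < #|{: config q V}|%:R :> R.
Proof. by rewrite ltr0n card_ffun card_ord expn_gt0. Qed.

Lemma monochromaticP s (f : {set V}) :
  reflect (forall x y, x \in f -> y \in f -> s x = s y) (monochromatic s f).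
Proof.
apply: (iffP forallP) => [H x y xf yf|H x].
  by have /implyP/(_ xf)/forallP/(_ y)/implyP/(_ yf)/eqP := H x.
by apply/implyP => xf; apply/forallP => y; apply/implyP => yf; apply/eqP/H.
Qed.

Lemma eq_monochromatic s t (f : {set V}) :
  (forall x y, x \in f -> y \in f -> (s x == s y) = (t x == t y)) ->
  monochromatic s f = monochromatic t f.
Proof.
move=> H; apply/monochromaticP/monochromaticP => M x y xf yf; apply/eqP.
  by rewrite -H //; apply/eqP/M.
by rewrite H //; apply/eqP/M.
Qed.

Lemma monochromatic_set2 s x y : monochromatic s [set x; y] = (s x == s y).
Proof.
apply/monochromaticP/eqP => [|e a b]; first by apply; rewrite !inE eqxx ?orbT.
by rewrite !inE => /orP[]/eqP -> /orP[]/eqP ->.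
Qed.

Definition separated F (W : {set V}) : Prop :=
  forall f, f \in F -> f \subset W \/ f \subset ~: W.

(** Both factors keep the full vertex type. [merge] takes from each the colours on its own side, and
    the redundant colours only multiply the counting measure by a constant. Pairs of bond sets
    outside [F1] and [F2] have weight 0, which makes the union injective on the good ones. *)
Lemma es_gap_separated F (W : {set V}) (gap : R) : 0 <= gap -> separated F W ->
  es_gap [set f in F | f \subset W] gap ->
  es_gap [set f in F | ~~ (f \subset W)] gap -> es_gap F gap.
Proof.
move=> gap0 sepF; set F1 := [set f in F | _]; set F2 := [set f in F | _].
move=> P1 P2.
have mono1 z f : f \in F1 -> monochromatic (merge W z.1 z.2) f = monochromatic z.1 f.
  rewrite inE => /andP[_ /subsetP fW]; apply: eq_monochromatic => x y xf yf.
  by rewrite !ffunE !fW.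
have mono2 z f : f \in F2 -> monochromatic (merge W z.1 z.2) f = monochromatic z.2 f.
  rewrite inE => /andP[fF fnW]; apply: eq_monochromatic => x y xf yf.
  have [fW|/subsetP fW] := sepF _ fF; first by rewrite fW in fnW.
  have := fW _ xf; have := fW _ yf; rewrite !inE !ffunE => /negbTE -> /negbTE ->.
  by [].
have FE f : (f \in F) = (f \in F1) || (f \in F2).
  by rewrite !inE; case: (f \in F) => //=; case: (f \subset W).
have dF f : f \in F1 -> (f \in F2) = false.
  by rewrite !inE => /andP[-> ->].
have dF2 f : f \in F2 -> (f \in F1) = false.
  by rewrite !inE => /andP[-> /negbTE ->].
rewrite /es_gap.
refine (@poincare_pushforward R _ _ _ _ (es F)
  (fun (z : config q V * config q V) (A : {set {set V}} * {set {set V}}) =>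
     es F1 z.1 A.1 * es F2 z.2 A.2)
  (fun z => merge W z.1 z.2) (fun A : {set {set V}} * {set {set V}} => A.1 :|: A.2)
  [pred A : {set {set V}} * {set {set V}} | (A.1 \subset F1) && (A.2 \subset F2)] _ gap card_config_gt0 _ _ _ _ _ _).
- exact: es_ge0.
- exact: sum_merge.
- move=> [A1 A2] [B1 B2]; rewrite /in_mem /= => /andP[/subsetP a1 /subsetP a2].
  move=> /andP[/subsetP b1 /subsetP b2] E.
  have {}E f : (f \in A1) || (f \in A2) = (f \in B1) || (f \in B2).
    by have /setP/(_ f) := E; rewrite !inE.
  congr (_, _); apply/setP => f; have := E f.
  + have [fF|nf] := boolP (f \in F1).
      have -> : (f \in A2) = false by apply/negbTE/negP => /a2; rewrite dF.
      have -> : (f \in B2) = false by apply/negbTE/negP => /b2; rewrite dF.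
      by rewrite !orbF.
    have -> : (f \in A1) = false by apply/negbTE; apply: contra nf; apply: a1.
    by have -> : (f \in B1) = false by apply/negbTE; apply: contra nf; apply: b1.
  + have [fF|nf] := boolP (f \in F2).
      have -> : (f \in A1) = false by apply/negbTE/negP => /a1; rewrite dF2.
      have -> : (f \in B1) = false by apply/negbTE/negP => /b1; rewrite dF2.
      by [].
    have -> : (f \in A2) = false by apply/negbTE; apply: contra nf; apply: a2.
    by have -> : (f \in B2) = false by apply/negbTE; apply: contra nf; apply: b2.
- move=> z [A1 A2] /=; case: ifP => [/andP[/subsetP a1 /subsetP a2]|/negbT].
    rewrite /es -big_split /=; apply: eq_bigr => f _; rewrite /es_factor FE in_setU.
    have [f1|nf1] := boolP (f \in F1).
      have -> : (f \in A2) = false by apply/negbTE/negP => /a2; rewrite dF.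
      by rewrite dF // mono1 // orbF; case: (f \in A1); rewrite mulr1.
    have -> : (f \in A1) = false by apply/negbTE; apply: contra nf1; apply: a1.
    have [f2|nf2] := boolP (f \in F2).
      by rewrite mono2 //=; case: (f \in A2); rewrite mul1r.
    have -> : (f \in A2) = false by apply/negbTE; apply: contra nf2; apply: a2.
    by rewrite mulr1.
  rewrite negb_and => /orP[/subsetPn[f fA fF]|/subsetPn[f fA fF]].
    rewrite [X in X * _](_ : _ = 0) ?mul0r // /es (bigD1 f) //= /es_factor fA.
    by rewrite (negbTE fF) mulr0 mul0r.
  rewrite [X in _ * X](_ : _ = 0) ?mulr0 // /es (bigD1 f) //= /es_factor fA.
  by rewrite (negbTE fF) mulr0 mul0r.
- move=> z; rewrite sum_es.
  rewrite -(pair_bigA _ (fun A1 A2 => es F1 z.1 A1 * es F2 z.2 A2)) /=.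
  transitivity (weight F1 z.1 * weight F2 z.2).
    rewrite -!sum_es mulr_suml; apply: eq_bigr => A1 _.
    by rewrite mulr_sumr.
  rewrite /weight [\prod_(f in F1) _]big_mkcond [\prod_(f in F2) _]big_mkcond.
  rewrite [RHS]big_mkcond -big_split; apply: eq_bigr => f _ /=.
  rewrite FE; case f1: (f \in F1); first by rewrite dF // mono1 //= mulr1.
  by case f2: (f \in F2); rewrite /= ?mono2 // ?mul1r.
- apply: poincare_prod => //; [exact: es_ge0|exact: es_ge0|].
  under eq_bigr => s _ do rewrite sum_es.
  rewrite (bigD1 [ffun=> ord0]) //= ltr_pwDl ?weight_gt0 //.
  by apply: sumr_ge0 => s _; apply/ltW/weight_gt0.
Qed.

Section Bridge.
Variables (F : {set {set V}}) (W : {set V}) (u v : V).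
Hypotheses (sepF : separated F W) (uW : u \in W) (vW : v \notin W).

(* Rotating all the colours outside [W] by a common amount keeps the bonds of
   [F] intact and prescribes the colour difference [z.2] across the bridge. *)
Definition twist (z : config q V * 'I_q) : config q V :=
  [ffun x => if x \in W then z.1 x else z.1 x + (z.1 u + z.2 - z.1 v)].

Lemma sum_twist (h : config q V -> R) :
  \sum_z h (twist z) = q%:R * \sum_s h s.
Proof.
(* The second component records the rotation, so that both [z.1] and [z.2] can be recovered. *)
pose m (z : config q V * 'I_q) := (twist z, z.1 u + z.2 - z.1 v).
have m_inj : injective m.
  move=> [s a] [t b] st_ab; have /ffunP E := congr1 fst st_ab.
  have K : s u + a - s v = t u + b - t v := congr1 snd st_ab.
  have st : s = t.
    apply/ffunP => x; have := E x; rewrite !ffunE /=; case: ifP => // _.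
    by rewrite K => /addIr.
  by move: K; rewrite st => /addIr/addrI ->.
have -> : \sum_z h (twist z) = \sum_z h (m z).1 by [].
rewrite -(reindex m (P := xpredT) (F := fun z => h z.1)); last first.
  exact/onW_bij/injF_bij.
rewrite -(pair_bigA _ (fun s (t : 'I_q) => h s)) /= mulr_sumr.
by apply: eq_bigr => s _; rewrite sumr_const card_ord mulr_natl.
Qed.

Lemma monochromatic_twist z f : f \in F ->
  monochromatic (twist z) f = monochromatic z.1 f.
Proof.
move=> fF; apply: eq_monochromatic => x y xf yf; rewrite !ffunE.
have [/subsetP fW|/subsetP fW] := sepF fF; first by rewrite !fW.
have := fW _ xf; have := fW _ yf; rewrite !inE => /negbTE -> /negbTE ->.
by rewrite (inj_eq (addIr _)).
Qed.

Lemma monochromatic_twist_bridge z :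
  monochromatic (twist z) [set u; v] = (z.2 == 0).
Proof.
rewrite monochromatic_set2 !ffunE uW (negbTE vW).
by rewrite addrC subrK -[X in X == _]addr0 (inj_eq (addrI _)) eq_sym.
Qed.

Lemma bridge_notin : [set u; v] \notin F.
Proof.
apply/negP => /sepF[/subsetP H|/subsetP H].
  by have := H v; rewrite !inE eqxx orbT (negbTE vW) => /(_ isT).
by have := H u; rewrite !inE eqxx uW => /(_ isT).
Qed.

(** In the coordinates of [twist] the difference [z.2] is independent of [z.1], and the bridge is
    monochromatic when it vanishes: the coupling becomes the product of [es F] with the one-edge
    model [nu2]. *)
Lemma es_gap_bridge (gap : R) : 0 <= gap -> gap <= expR (- beta) ->
  es_gap F gap -> es_gap ([set u; v] |: F) gap.
Proof.
move=> gap0 gapr P; set e := [set u; v]; have eF := bridge_notin.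
pose nu2 (a : 'I_q) (b : bool) : R := if b then p * (a == 0)%:R else r.
pose nu0 (a : 'I_q) (b : bool) : R := (~~ b)%:R.
have nu2_ge0 a b : 0 <= nu2 a b by rewrite /nu2; case: b; rewrite ?mulr_ge0.
(* [nu2] is at least [expR (- beta)] times the always closed model [nu0], which has gap 1, and its
   marginal is at most 1. *)
have P2 : poincare nu2 gap.
  apply: (poincare_weaken nu2_ge0 gapr); rewrite -[X in poincare _ X]mulr1.
  apply: (@poincare_dominated _ _ _ nu2 nu0) => //.
  - by move=> a []; rewrite /nu2 /nu0 ?mulr0 ?mulr_ge0 ?mulr1.
  - move=> a; rewrite !big_bool /nu2 /nu0 /= add0r.
    by case: eqP; rewrite ?mulr1 ?mulr0 ?add0r ?subrK ?r_le1 ?subrK.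
  - apply: (@poincare_deterministic _ _ _ _ false) => // a.
    by rewrite big_bool /nu0 /= add0r.
rewrite /es_gap.
refine (@poincare_pushforward R _ _ _ _ (es (e |: F))
  (fun (z : config q V * 'I_q) (B : {set {set V}} * bool) =>
     es F z.1 B.1 * nu2 z.2 B.2)
  twist (fun B : {set {set V}} * bool => if B.2 then e |: B.1 else B.1)
  [pred B : {set {set V}} * bool | B.1 \subset F] q%:R gap _ _ _ _ _ _ _).
- by rewrite ltr0n.
- exact: es_ge0.
- exact: sum_twist.
- move=> [A a] [B b]; rewrite /in_mem /= => /subsetP AF /subsetP BF E.
  have eA : (e \in A) = false by apply: contraNF eF; apply: AF.
  have eB : (e \in B) = false by apply: contraNF eF; apply: BF.
  have ab : a = b.
    have /setP/(_ e) := E.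
    by case: {E}a; case: b; rewrite ?(in_setU, in_set1) ?eqxx ?eA ?eB.
  congr (_, _) => //; apply/setP => f; have [->|ne] := eqVneq f e.
    by rewrite eA eB.
  have /setP/(_ f) := E; rewrite ab.
  by case: (b); rewrite ?(in_setU, in_set1) ?(negbTE ne).
- move=> [s a] [A b] /=; case: ifP => [/subsetP AF|/negbT/subsetPn[f fA fF]].
    rewrite /es (bigD1 e) //= [in RHS](bigD1 e) //=.
    have eA : (e \in A) = false by apply: contraNF eF; apply: AF.
    rewrite {1 3}/es_factor eA (negbTE eF) mul1r mulrC; congr (_ * _).
      rewrite /nu2; case: b; rewrite ?(in_setU, in_set1) ?eqxx ?eA //=.
      by rewrite monochromatic_twist_bridge.
    apply: eq_bigr => f fe; rewrite /es_factor.
    have -> : (f \in (if b then e |: A else A)) = (f \in A).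
      by case: (b); rewrite // in_setU in_set1 (negbTE fe).
    rewrite in_setU in_set1 (negbTE fe) /=; case: (f \in A) => //.
    by case fF: (f \in F) => //=; rewrite monochromatic_twist.
  rewrite [X in X * _](_ : _ = 0) ?mul0r // /es (bigD1 f) //= /es_factor fA.
  by rewrite (negbTE fF) mulr0 mul0r.
- move=> z; rewrite sum_es.
  rewrite -(pair_bigA _ (fun A b => es F z.1 A * nu2 z.2 b)) /=.
  transitivity (weight F z.1 * \sum_b nu2 z.2 b).
    by rewrite -sum_es mulr_suml; apply: eq_bigr => A1 _; rewrite mulr_sumr.
  rewrite /weight big_setU1 //= monochromatic_twist_bridge mulrC; congr (_ * _).
    rewrite big_bool /nu2 /=; case: eqP => _; rewrite ?mulr1 ?mulr0.
      exact: subrK.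
    exact: add0r.
  by apply: eq_bigr => f fF; rewrite monochromatic_twist.
- apply: poincare_prod => //; [exact: es_ge0|].
  under eq_bigr => s _ do rewrite sum_es.
  rewrite (bigD1 [ffun=> ord0]) //= ltr_pwDl ?weight_gt0 //.
  by apply: sumr_ge0 => s _; apply/ltW/weight_gt0.
Qed.

End Bridge.

End BondModel.

(** * Reversible chains and mixing *)

Section Kernel.
Variables (R : realType) (X : finType) (P : X -> X -> R) (mu : X -> R).

Definition markov_op (f : X -> R) (x : X) : R := \sum_y P x y * f y.

Lemma kernel_pow_sum t (f : X -> R) x :
  \sum_y kernel_pow P t x y * f y = iter t markov_op f x.
Proof.
elim: t x => [|t IH] x /=.
  rewrite (bigD1 x) //= eqxx mul1r big1 ?addr0 // => y yx.
  by rewrite eq_sym (negbTE yx) mul0r.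
rewrite /markov_op; under [RHS]eq_bigr => z _ do rewrite -IH mulr_sumr.
rewrite exchange_big /=; apply: eq_bigr => y _; rewrite mulr_suml.
by apply: eq_bigr => z _; rewrite mulrA.
Qed.

Lemma mixing_time_le (t : nat) (B : R) :
  tv_dist P mu t <= (2 * expR 1)^-1 -> t%:R <= B ->
  (mixing_time P mu <= B%:E)%E.
Proof.
move=> tvt tB; apply: (@le_trans _ _ (t%:R)%:E); last by rewrite lee_fin.
by apply: ereal_inf_lbound; exists t.
Qed.

Hypotheses (P0 : forall x y, 0 <= P x y) (P1 : forall x, \sum_y P x y = 1).
Hypotheses (mu0 : forall x, 0 <= mu x) (mu1 : \sum_x mu x = 1).
Hypothesis muP : forall y, \sum_x mu x * P x y = mu y.

Lemma iter_markov_opB t (f : X -> R) c x :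
  iter t markov_op (fun y => f y - c) x = iter t markov_op f x - c.
Proof.
elim: t x => //= t IH x; rewrite /markov_op.
under eq_bigr => y _ do rewrite IH mulrBr.
by rewrite sumrB -mulr_suml P1 mul1r.
Qed.

Definition centered_ind (B : {set X}) (x : X) : R :=
  (x \in B)%:R - \sum_(z in B) mu z.

Lemma tv_dist_le t c : 0 <= c ->
  (forall x B, `|iter t markov_op (centered_ind B) x| <= c) ->
  tv_dist P mu t <= c.
Proof.
move=> c0 H; apply: bigmax_le => // x _; apply: bigmax_le => // B _.
rewrite distrC; apply: le_trans (H x B); rewrite iter_markov_opB -kernel_pow_sum.
rewrite le_eqVlt; apply/orP; left; apply/eqP; congr `|_ - _|.
by rewrite big_mkcond; apply: eq_bigr => y _; case: ifP; rewrite ?mulr1 ?mulr0.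
Qed.

Lemma sum_mu_markov_op (f : X -> R) :
  \sum_x mu x * markov_op f x = \sum_x mu x * f x.
Proof.
under eq_bigr => x _ do rewrite mulr_sumr.
rewrite exchange_big; apply: eq_bigr => y _.
by under eq_bigr => x _ do rewrite mulrA; rewrite -mulr_suml muP.
Qed.

Lemma measure_in01 (B : {set X}) : 0 <= \sum_(z in B) mu z <= 1.
Proof.
rewrite sumr_ge0 //= -mu1 [X in _ <= X](bigID (mem B)) /= lerDl.
exact: sumr_ge0.
Qed.

Lemma sum_mu_centered (B : {set X}) : \sum_x mu x * centered_ind B x = 0.
Proof.
under eq_bigr => x _ do rewrite mulrBr.
rewrite sumrB -mulr_suml mu1 mul1r; apply/eqP; rewrite subr_eq0; apply/eqP.
by rewrite [RHS]big_mkcond; apply: eq_bigr => x _; case: ifP;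
  rewrite ?mulr1 ?mulr0.
Qed.

Lemma centered_ind_le1 (B : {set X}) x : `|centered_ind B x| <= 1.
Proof.
rewrite /centered_ind; have /andP[] := measure_in01 B; set m := \sum_(z in B) mu z.
by move=> m0 m1; rewrite ler_norml; case: (x \in B) => /=; lra.
Qed.

Lemma markov_op_bound (f : X -> R) a b :
  (forall x, a <= f x <= b) -> forall x, a <= markov_op f x <= b.
Proof.
move=> H x; have E c : \sum_y P x y * c = c by rewrite -mulr_suml P1 mul1r.
apply/andP; split; [rewrite -[leLHS]E|rewrite -[leRHS]E];
  by apply: ler_sum => y _; rewrite ler_wpM2l //; case/andP: (H y).
Qed.

Lemma iter_markov_op_le1 t (f : X -> R) :
  (forall x, `|f x| <= 1) -> forall x, `|iter t markov_op f x| <= 1.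
Proof.
move=> f1; elim: t => // t IH x /=; rewrite ler_norml.
by apply: markov_op_bound => y; rewrite -ler_norml.
Qed.

Section Doeblin.
Variable eta : R.
Hypotheses (eta01 : 0 <= eta <= 1) (Peta : forall x y, eta / #|X|%:R <= P x y).

(** The part [eta / #|X|] of the kernel does not depend on [x] and adds the same constant [m] to
    every value; only mass [1 - eta] is left to create oscillation. *)
Lemma oscillation_contract (f : X -> R) a rho : (0 < #|X|)%N ->
  (forall x, a <= f x <= a + rho) ->
  exists b, forall x, b <= markov_op f x <= b + (1 - eta) * rho.
Proof.
move=> X0 H; set N : R := #|X|%:R.
have N0 : 0 < N by rewrite ltr0n.
pose m := \sum_y eta / N * f y.
have W : forall x, \sum_y (P x y - eta / N) = 1 - eta.
  move=> x; rewrite sumrB P1 sumr_const -[_ *+ _]mulr_natr -/N divfK //.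
  exact: lt0r_neq0.
exists (m + (1 - eta) * a) => x.
have -> : markov_op f x = m + \sum_y (P x y - eta / N) * f y.
  by rewrite /m -big_split; apply: eq_bigr => y _ /=; rewrite mulrBl addrC subrK.
have Q0 y : 0 <= P x y - eta / N by rewrite subr_ge0.
rewrite -addrA -mulrDr !lerD2l -(W x) !mulr_suml; apply/andP.
by split; apply: ler_sum => y _; rewrite ler_wpM2l //; case/andP: (H y).
Qed.

Lemma doeblin_tv t : (0 < #|X|)%N -> tv_dist P mu t <= (1 - eta) ^+ t.
Proof.
move=> X0; apply: tv_dist_le.
  by apply: exprn_ge0; rewrite subr_ge0; case/andP: eta01.
move=> x B; set f := iter t _ _.
have [a Ha] : exists a, forall x, a <= f x <= a + (1 - eta) ^+ t.
  rewrite /f; elim: (t) => [|k [a IH]]; last first.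
    have [b Hb] := oscillation_contract X0 IH; exists b => z.
    by rewrite exprS; apply: Hb.
  exists (- \sum_(z in B) mu z) => z /=; rewrite /centered_ind expr0.
  by case: (z \in B); rewrite addrC ?lerDl ?lerD2l /= ?ler01 ?lexx ?lerDr ?ler01.
(* A function of mean zero has 0 in any interval containing its range, so the length of the interval
   bounds its absolute value. *)
have fE : \sum_z mu z * f z = 0.
  rewrite /f; elim: (t) => [|k IH]; first exact: sum_mu_centered.
  by rewrite /= sum_mu_markov_op.
have E c : \sum_y mu y * c = c by rewrite -mulr_suml mu1 mul1r.
have a0 : a <= 0.
  rewrite -fE -[leLHS]E; apply: ler_sum => y _; rewrite ler_wpM2l //.
  by case/andP: (Ha y).
have a1 : 0 <= a + (1 - eta) ^+ t.
  rewrite -[leLHS]fE -[leRHS]E; apply: ler_sum => y _; rewrite ler_wpM2l //.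
  by case/andP: (Ha y).
by have /andP[] := Ha x; rewrite ler_norml; lra.
Qed.

End Doeblin.
End Kernel.

(** * Two-step chains as kernels: drift and warm starts *)

Section TwoStepKernel.
Variables (R : realType) (X Y : finType) (nu : X -> Y -> R).
Hypothesis nu0 : forall x y, 0 <= nu x y.
Let w x := \sum_y nu x y.
Let g y := \sum_x nu x y.
Hypothesis w_gt0 : forall x, 0 < w x.

Let g_ge0 y : 0 <= g y. Proof. exact: sumr_ge0. Qed.
Let w_ge0 x : 0 <= w x. Proof. exact: ltW. Qed.

Definition two_step_kernel (x x' : X) : R :=
  \sum_y nu x y / w x * (nu x' y / g y).

Lemma markov_op_two_step (f : X -> R) x :
  markov_op two_step_kernel f x = up nu (down nu f) x.
Proof.
rewrite /markov_op /up /wmean mulr_suml.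
under eq_bigr => y _ do rewrite mulr_suml.
rewrite exchange_big; apply: eq_bigr => y _; rewrite /down /wmean.
rewrite mulrAC mulr_suml !mulr_sumr; apply: eq_bigr => z _.
by rewrite -/(w x) -/(g y); ring.
Qed.

Lemma iter_two_step t (f : X -> R) :
  iter t (markov_op two_step_kernel) f =1 iter t (up nu \o down nu) f.
Proof.
elim: t => //= t IH x; rewrite -markov_op_two_step.
by apply: eq_bigr => y _; rewrite IH.
Qed.

Lemma mul_div_marginal x y : nu x y / g y * g y = nu x y.
Proof.
have [g0|/divfK //] := eqVneq (g y) 0; rewrite g0 mulr0.
by move/eqP: g0; rewrite psumr_eq0 // => /allP/(_ x (mem_index_enum x))/eqP.
Qed.

Lemma two_step_kernel_ge0 x y : 0 <= two_step_kernel x y.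
Proof.
by apply: sumr_ge0 => z _; rewrite !mulr_ge0 ?invr_ge0.
Qed.

Lemma two_step_kernel_sum x : \sum_y two_step_kernel x y = 1.
Proof.
rewrite exchange_big /= -[RHS](divff (lt0r_neq0 (w_gt0 x))) mulr_suml.
apply: eq_bigr => y _; rewrite -mulr_sumr -mulr_suml -/(g y).
by rewrite -[in RHS](mul_div_marginal x y); ring.
Qed.

Lemma two_step_stationary (Z : R) y :
  \sum_x w x / Z * two_step_kernel x y = w y / Z.
Proof.
rewrite /two_step_kernel; under eq_bigr => x _ do rewrite mulr_sumr.
rewrite exchange_big mulr_suml; apply: eq_bigr => z _.
transitivity (nu y z / g z * (\sum_x nu x z) / Z); last by rewrite mul_div_marginal.
rewrite mulr_sumr mulr_suml; apply: eq_bigr => x _.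
by rewrite -/(g z); set i := (g z)^-1; set j := Z^-1; field; exact: lt0r_neq0.
Qed.

Lemma wmean_le (T : finType) (u f : T -> R) c : (forall x, 0 <= u x) ->
  0 <= c -> (forall x, f x <= c) -> wmean u f <= c.
Proof.
move=> u0 c0 H; rewrite /wmean; have [->|ne] := eqVneq (\sum_x u x) 0.
  by rewrite invr0 mulr0.
rewrite ler_pdivrMr ?lt0r ?ne ?sumr_ge0 // mulr_sumr.
by apply: ler_sum => x _; rewrite mulrC ler_wpM2r.
Qed.

Lemma le_wmean (T : finType) (u f h : T -> R) : (forall x, 0 <= u x) ->
  (forall x, f x <= h x) -> wmean u f <= wmean u h.
Proof.
move=> u0 fh; rewrite ler_wpM2r ?invr_ge0 ?sumr_ge0 //.
by apply: ler_sum => x _; rewrite ler_wpM2l.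
Qed.

Lemma norm_wmean (T : finType) (u f : T -> R) : (forall x, 0 <= u x) ->
  `|wmean u f| <= wmean u (fun x => `|f x|).
Proof.
move=> u0; have s0 : 0 <= \sum_x u x by apply: sumr_ge0.
rewrite /wmean normrM normfV (ger0_norm s0) ler_wpM2r ?invr_ge0 //.
apply: le_trans (ler_norm_sum _ _ _) _; apply: ler_sum => x _.
by rewrite normrM ger0_norm.
Qed.

Lemma wmean_affine (T : finType) (u f : T -> R) a b : (forall x, 0 <= u x) ->
  0 <= b -> wmean u (fun x => a * f x + b) <= a * wmean u f + b.
Proof.
move=> u0 b0.
have -> : wmean u (fun x => a * f x + b) = a * wmean u f + wmean u (fun=> b).
  rewrite /wmean mulrA -mulrDl; congr (_ / _); rewrite mulr_sumr -big_split.
  by apply: eq_bigr => x _; rewrite /=; ring.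
by rewrite lerD2l; apply: wmean_le.
Qed.

Lemma wmean_sum (T I : finType) (Q : pred I) (u : T -> R) (f : I -> T -> R) :
  wmean u (fun x => \sum_(i | Q i) f i x) = \sum_(i | Q i) wmean u (f i).
Proof.
rewrite /wmean -mulr_suml exchange_big /=; congr (_ / _).
by apply: eq_bigr => x _; rewrite mulr_sumr.
Qed.

Lemma wmeanZ (T : finType) (u : T -> R) a (f : T -> R) :
  wmean u (fun x => a * f x) = a * wmean u f.
Proof.
rewrite /wmean mulrA mulr_sumr; congr (_ / _).
by apply: eq_bigr => x _; rewrite mulrCA.
Qed.

(** Regrouping lets the iteration run on bond configurations, where being covered is a function of
    the state. *)
Lemma iter_up_down t (f : X -> R) x :
  iter t.+1 (up nu \o down nu) f x =
  up nu (iter t (down nu \o up nu) (down nu f)) x.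
Proof. by elim: t x => //= t IH x; congr wmean; apply/funext => y /=;
  congr wmean; apply/funext => z; apply: IH. Qed.

(** A drift condition: iterates approach the fixed point [b / (1 - a)] of [z |-> a z + b]
    geometrically. The extra factor [a] comes from the first bond configuration drawn from [x]. *)
Lemma up_iter_le t (psi : Y -> R) (a b : R) : 0 <= a < 1 -> 0 <= b ->
  (forall x, up nu psi x <= a) ->
  (forall y, down nu (up nu psi) y <= a * psi y + b) ->
  forall x, up nu (iter t (down nu \o up nu) psi) x <= a ^+ t.+1 + b / (1 - a).
Proof.
case/andP=> a0 a1 b0 H1 H2 x; have a1' : 0 < 1 - a by rewrite subr_gt0.
set c := b / (1 - a); have c0 : 0 <= c by rewrite divr_ge0 // ltW.
have E : b = (1 - a) * c by rewrite mulrC divfK // lt0r_neq0.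
have at1 k : 0 <= 1 - a ^+ k by rewrite subr_ge0 exprn_ile1 // ltW.
have H y : iter t (down nu \o up nu) psi y <= a ^+ t * psi y + (1 - a ^+ t) * c.
  elim: t y => [|t IH] y; first by rewrite expr0 mul1r subrr mul0r addr0.
  have b'0 : 0 <= (1 - a ^+ t) * c by rewrite mulr_ge0.
  have step : iter t.+1 (down nu \o up nu) psi y <=
      a ^+ t * down nu (up nu psi) y + (1 - a ^+ t) * c.
    rewrite iterS /=.
    apply: (le_trans (y := down nu
      (fun z => a ^+ t * up nu psi z + (1 - a ^+ t) * c) y)).
      apply: le_wmean => // z.
      apply: (le_trans (y := up nu (fun v => a ^+ t * psi v + (1 - a ^+ t) * c) z)).
        exact: le_wmean.
      exact: wmean_affine.
    exact: wmean_affine.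
  apply: le_trans step _.
  apply: le_trans (lerD (ler_wpM2l (exprn_ge0 t a0) (H2 y)) (lexx _)) _.
  by rewrite le_eqVlt; apply/orP; left; apply/eqP; rewrite E exprS; ring.
apply: le_trans (le_wmean _ H) _ => //.
apply: le_trans (wmean_affine _ _ _ _) _ => //; first exact: mulr_ge0.
rewrite exprSr; apply: (lerD (ler_wpM2l (exprn_ge0 t a0) (H1 x))).
by rewrite ler_piMl // gerBl exprn_ge0.
Qed.

Lemma norm_up_iter t (phi psi : Y -> R) : (forall y, `|phi y| <= psi y) ->
  forall x, `|up nu (iter t (down nu \o up nu) phi) x| <=
            up nu (iter t (down nu \o up nu) psi) x.
Proof.
move=> H x; have {}H y : `|iter t (down nu \o up nu) phi y| <=
    iter t (down nu \o up nu) psi y.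
  elim: t y => //= t IH y.
  apply: le_trans (norm_wmean _ _) _ => //; apply: le_wmean => // z.
  by apply: le_trans (norm_wmean _ _) _ => //; apply: le_wmean.
by apply: le_trans (norm_wmean _ _) _ => //; apply: le_wmean.
Qed.

(** [M] bounds the density of the conditional law given [y] with respect to the unnormalised [w], so
    an L2 norm controls a pointwise value. *)
Lemma down_sqr_le (phi : X -> R) y (M : R) :
  (forall x, nu x y / g y <= M * w x) ->
  down nu phi y ^+ 2 <= M * \sum_x w x * phi x ^+ 2.
Proof.
move=> H; apply: (@le_trans _ _ (wmean (nu^~ y) (fun x => phi x ^+ 2))).
  rewrite /down /wmean; have [->|ne] := eqVneq (\sum_x nu x y) 0.
    by rewrite invr0 !mulr0 expr0n.
  have g0 : 0 < \sum_x nu x y by rewrite lt0r ne sumr_ge0.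
  rewrite ler_pdivlMr //; set S := \sum_x nu x y * phi x.
  have -> : (S / \sum_x nu x y) ^+ 2 * \sum_x nu x y = S ^+ 2 / \sum_x nu x y.
    by field.
  rewrite ler_pdivrMr // mulrC; exact: jensen_sqr.
rewrite /wmean mulr_suml mulr_sumr; apply: ler_sum => x _.
by rewrite mulrAC mulrA ler_wpM2r ?sqr_ge0.
Qed.

End TwoStepKernel.

(** * The Swendsen-Wang chain *)

Section SwendsenWangKernel.
Variables (R : realType) (beta : R) (q' : nat) (V : finType).
Hypothesis beta0 : 0 < beta.
Local Notation q := q'.+1.
Implicit Types (F A : {set {set V}}) (s : config q V).
Local Notation r := (expR (- beta) : R).
Local Notation p := (1 - r).
Let r_gt0 : 0 < r. Proof. exact: expR_gt0. Qed.
Let p_gt0 : 0 < p. Proof. by rewrite subr_gt0 expRN_lt1. Qed.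
Let es_nonneg F s A : 0 <= es beta F s A. Proof. exact: es_ge0. Qed.

(** For a set of pairs, the number of compatible configurations is [q] to the number of components.
    Counting configurations lets most arguments avoid components altogether. *)
Definition compat A s : bool := [forall f in A, monochromatic s f].
Definition ncompat A : nat := #|[set s : config q V | compat A s]|.

Lemma compatP A s : reflect (forall f, f \in A -> monochromatic s f) (compat A s).
Proof. exact: forall_inP. Qed.

Lemma sum_compat A : \sum_s (compat A s)%:R = (ncompat A)%:R :> R.
Proof.
rewrite /ncompat -sum1_card natr_sum [RHS]big_mkcond.
by apply: eq_bigr => s _; rewrite inE; case: compat.
Qed.

Lemma ncompat_gt0 A : (0 < ncompat A)%N.
Proof.
apply/card_gt0P; exists [ffun=> ord0]; rewrite inE; apply/compatP => f _.
by apply/monochromaticP => x y _ _; rewrite !ffunE.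
Qed.

(** [twist] makes the colour difference across the bridge uniform, so a fraction 1/q of the
    compatible configurations has it monochromatic. This serves for isolated vertices and, with two
    colours, for counting the edges of a forest. *)
Lemma sum_compat_bridge A (W : {set V}) (u v : V) :
  separated A W -> u \in W -> v \notin W ->
  q%:R * \sum_(s : config q V) (compat A s)%:R * (monochromatic s [set u; v])%:R =
  (ncompat A)%:R :> R.
Proof.
move=> sep uW vW; pose h (s : config q V) : R :=
  (compat A s)%:R * (monochromatic s [set u; v])%:R.
have Ez z : h (twist W u v z) = (compat A z.1)%:R * (z.2 == 0)%:R.
  rewrite /h monochromatic_twist_bridge //; congr (_%:R * _).
  congr nat_of_bool; apply/compatP/compatP => H f fA.
    by rewrite -(monochromatic_twist u v sep z fA); apply: H.
  by rewrite (monochromatic_twist u v sep z fA); apply: H.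
rewrite -(sum_twist W u v h); under eq_bigr => z _ do rewrite Ez.
rewrite -(pair_bigA _ (fun s (a : 'I_q) => (compat A s)%:R * (a == 0)%:R)) /=.
rewrite -sum_compat; apply: eq_bigr => s _; rewrite (bigD1 0) //= mulr1.
by rewrite big1 ?addr0 // => a /negbTE ->; rewrite mulr0.
Qed.

Definition es_const F A : R :=
  \prod_f (if f \in A then p else if f \in F then r else 1).

Lemma es_const_gt0 F A : 0 < es_const F A.
Proof.
by apply: prodr_gt0 => f _; case: ifP => _; [exact: p_gt0|case: ifP].
Qed.

Lemma esE F A s : A \subset F ->
  es beta F s A = es_const F A * (compat A s)%:R.
Proof.
move=> /subsetP AF; rewrite /es /es_factor; have [/compatP H|] := boolP (compat A s).
  rewrite mulr1; apply: eq_bigr => f _; case: ifP => // fA.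
  by rewrite AF // H // mulr1.
rewrite negb_forall => /existsP[f]; rewrite negb_imply => /andP[fA nm].
by rewrite (bigD1 f) //= fA (negbTE nm) andbF !mulr0 mul0r.
Qed.

Lemma es_out F A s : ~~ (A \subset F) -> es beta F s A = 0.
Proof.
by case/subsetPn => f fA fF; rewrite /es (bigD1 f) //= /es_factor fA
  (negbTE fF) mulr0 mul0r.
Qed.

Lemma es_div_marginal F A s : A \subset F ->
  es beta F s A / (\sum_(s' : config q V) es beta F s' A) = (compat A s)%:R / (ncompat A)%:R.
Proof.
move=> AF; have -> : \sum_(s' : config q V) es beta F s' A = es_const F A * (ncompat A)%:R.
  by rewrite -sum_compat mulr_sumr; apply: eq_bigr => s' _; rewrite esE.
rewrite esE //; field.
by rewrite pnatr_eq0 -lt0n ncompat_gt0 lt0r_neq0 ?es_const_gt0.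
Qed.

Lemma card_mono_partition (P : {set {set V}}) : partition P [set: V] ->
  #|[set s : config q V | compat P s]| = (q ^ #|P|)%N.
Proof.
move=> /and3P[/eqP coverP tI P0].
pose T := {C : {set V} | C \in P}.
have pb x : pblock P x \in P by rewrite pblock_mem // coverP inE.
pose D x : T := exist (fun C => C \in P) (pblock P x) (pb x).
pose h (c : {ffun T -> 'I_q}) : config q V := [ffun x => c (D x)].
have pbC (C : T) x : x \in val C -> D x = C.
  by case: C => C CP /= xC; apply: val_inj => /=; apply: def_pblock.
have ne (C : T) : exists x, x \in val C.
  by case: C => C CP /=; apply/set0Pn; apply: contraNneq P0 => <-.
have h_inj : injective h.
  move=> c c' /ffunP E; apply/ffunP => C; have [x xC] := ne C.
  by have := E x; rewrite !ffunE (pbC C).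
have -> : [set s | compat P s] = h @: [set: {ffun T -> 'I_q}].
  apply/setP => s; rewrite inE; apply/compatP/imsetP => [H|[c _ ->] C CP].
    exists [ffun C : T => s (xchoose (ne C))]; rewrite ?inE //.
    apply/ffunP => x; rewrite !ffunE; set C := D x.
    have /monochromaticP := H _ (valP C); apply; last exact: (xchooseP (ne C)).
    by rewrite mem_pblock coverP.
  apply/monochromaticP => x y xC yC; rewrite !ffunE.
  by rewrite !(pbC (exist _ C CP)).
by rewrite card_imset // cardsT card_ffun card_ord card_sig.
Qed.

Section Recolor.
Variable A : {set {set V}}.
Hypothesis A2 : forall f, f \in A -> exists x y, f = [set x; y].

Let adj : rel V := [rel x y | [set x; y] \in A].

Let adj_equiv : equivalence_rel (connect adj).
Proof.
apply/equivalence_relP; split; first exact: connect0.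
by apply/same_connect/sym_connect_sym => u v; rewrite /adj /= setUC.
Qed.

Lemma components_partition : partition (components A) [set: V].
Proof.
apply: equivalence_partitionP => x y z _ _ _; exact: adj_equiv.
Qed.

Lemma compat_components s : compat (components A) s = compat A s.
Proof.
have E x y : connect adj x y ->
    exists2 C, C \in components A & (x \in C) && (y \in C).
  move=> xy; have /and3P[/eqP coverP tI _] := components_partition.
  exists (pblock (components A) x); first by rewrite pblock_mem // coverP inE.
  rewrite mem_pblock coverP inE /=.
  rewrite pblock_equivalence_partition ?inE //.
  by move=> a b c _ _ _; apply: adj_equiv.
apply/compatP/compatP => [H f fA|H C].
  have [x [y fE]] := A2 fA; rewrite fE monochromatic_set2; apply/eqP.
  have [|C CP /andP[xC yC]] := E x y; first by apply: connect1; rewrite /adj /= -fE.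
  by have /monochromaticP := H _ CP; apply.
case/imsetP => x _ ->; apply/monochromaticP => y z; rewrite !inE /=.
have K t : connect adj x t -> s x = s t.
  case/connectP => pth; elim: pth x => [|a pth IH] x /=; first by move=> _ ->.
  case/andP => xa pa lt; rewrite -(IH a) //; apply/eqP.
  by rewrite -monochromatic_set2; apply: H.
by move=> /K <- /K <-.
Qed.

Lemma recolor_probE s :
  recolor_prob R A s = (compat A s)%:R / (ncompat A)%:R.
Proof.
have -> : ncompat A = (q ^ #|components A|)%N.
  rewrite -(card_mono_partition components_partition) /ncompat.
  by congr #|pred_of_set _|; apply/setP => t; rewrite !inE compat_components.
rewrite -compat_components /recolor_prob; have [/compatP H|] := boolP (compat _ s).
  rewrite (eq_bigr (fun=> q%:R^-1)) => [|C CP]; last by rewrite H.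
  by rewrite prodr_const natrX exprVn div1r.
rewrite negb_forall => /existsP[C]; rewrite negb_imply => /andP[CP nm].
by rewrite (bigD1 C) //= (negbTE nm) !mul0r.
Qed.

End Recolor.

Section Chain.
Variable e : rel V.
Local Notation F := (edges e).

Lemma edgesP f : reflect (exists x y, e x y /\ f = [set x; y]) (f \in edges e).
Proof.
apply: (iffP imsetP) => [[[x y]]|[x [y [exy ->]]]].
  by rewrite inE /= => exy ->; exists x, y.
by exists (x, y); rewrite ?inE.
Qed.

Lemma bond_probE s A : A \subset mono_edges e s ->
  bond_prob beta e s A = es beta F s A / weight beta F s.
Proof.
move=> /subsetP AM; rewrite /bond_prob /es /weight [X in _ / X]big_mkcond -prodf_div.
rewrite big_mkcond; apply: eq_bigr => f _; rewrite /es_factor.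
have -> : (f \in mono_edges e s) = (f \in F) && monochromatic s f by rewrite inE.
case: (boolP (f \in A)) => fA.
  by have := AM _ fA; rewrite inE => /andP[-> ->]; rewrite mulr1 divr1.
case: (f \in F) => /=; last by rewrite divr1.
by case: monochromatic; rewrite ?divr1 // divff // lt0r_neq0.
Qed.

Lemma SW_two_step (s s' : config q V) :
  SW beta e s s' = two_step_kernel (es beta F) s s'.
Proof.
rewrite /SW /two_step_kernel big_mkcond; apply: eq_bigr => A _; rewrite sum_es.
case: ifP => AM.
  have AF : A \subset F by apply: subset_trans AM _; apply/subsetP => f; rewrite inE => /andP[].
  rewrite bond_probE // es_div_marginal // recolor_probE // => f /(subsetP AF).
  by case/edgesP => x [y [_ ->]]; exists x, y.
have [AF|/es_out ->] := boolP (A \subset F); last by rewrite !mul0r.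
rewrite esE //; have [/compatP H|_] := boolP (compat A s).
  case/negP: AM; apply/subsetP => f fA; rewrite inE H // andbT.
  exact: (subsetP AF).
by rewrite mulr0 !mul0r.
Qed.

Lemma potts_weight (s : config q V) :
  potts beta e s = weight beta F s / \sum_(s' : config q V) weight beta F s'.
Proof.
have E (t : config q V) : expR (- beta * hamiltonian R e t) = weight beta F t.
  rewrite /hamiltonian mulr_sumr expR_sum; apply: eq_bigr => f _.
  by case: monochromatic; rewrite ?subrr ?mulr0 ?expR0 // subr0 mulr1.
by rewrite /potts E; congr (_ / _); apply: eq_bigr.
Qed.

End Chain.

End SwendsenWangKernel.

(** * Total variation bounds for the Swendsen-Wang chain *)

Section Mixing.
Variables (R : realType) (beta : R) (q' : nat) (V : finType) (e : rel V).
Hypothesis beta0 : 0 < beta.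
Local Notation q := q'.+1.
Local Notation F := (edges e).
Local Notation r := (expR (- beta) : R).
Local Notation p := (1 - r).
Let r_gt0 : 0 < r. Proof. exact: expR_gt0. Qed.
Let r_ge0 : 0 <= r. Proof. exact: ltW. Qed.
Let r_le1 : r <= 1. Proof. exact/ltW/expRN_lt1. Qed.
Let p_gt0 : 0 < p. Proof. by rewrite subr_gt0 expRN_lt1. Qed.
Local Notation es := (@es R beta q' V F).
Local Notation w := (@weight R beta q' V F).
Local Notation mu := (@potts R beta q V e).
Local Notation K := (two_step_kernel es).
Local Notation Z := (\sum_(s' : config q V) w s').
Let muE s : mu s = w s / Z. Proof. exact: potts_weight. Qed.
Let es_nonneg s A : 0 <= es s A. Proof. exact: es_ge0. Qed.

Let w_gt0 s : 0 < \sum_A es s A.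
Proof. by rewrite sum_es weight_gt0. Qed.

Let Z_gt0 : 0 < Z.
Proof.
rewrite (bigD1 [ffun=> ord0]) //= ltr_pwDl ?weight_gt0 //.
by apply: sumr_ge0 => s _; apply/ltW/weight_gt0.
Qed.

Let K_ge0 s t : 0 <= K s t. Proof. exact: two_step_kernel_ge0. Qed.
Let K_sum s : \sum_t K s t = 1. Proof. exact: two_step_kernel_sum. Qed.
Let mu_ge0 s : 0 <= mu s.
Proof. by rewrite muE divr_ge0 ?ltW // weight_gt0. Qed.
Let mu_sum : \sum_s mu s = 1.
Proof.
under eq_bigr => s _ do rewrite muE.
by rewrite -mulr_suml divff // lt0r_neq0.
Qed.
Let mu_K t : \sum_s mu s * K s t = mu t.
Proof.
under eq_bigr => s _ do rewrite muE -sum_es.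
by rewrite muE (two_step_stationary es_nonneg w_gt0) sum_es.
Qed.

Lemma SW_mixing_timeE :
  SW_mixing_time beta q e = mixing_time K mu.
Proof.
rewrite /SW_mixing_time; congr mixing_time.
by apply/funext => s; apply/funext => t; rewrite SW_two_step.
Qed.

Let config_gt0 : (0 < #|{: config q V}|)%N.
Proof. by rewrite card_ffun card_ord expn_gt0. Qed.

(** Only the event that no bond is open is kept: after it, the recolouring is uniform over all
    configurations. *)
Lemma SW_doeblin t : tv_dist K mu t <= (1 - r ^+ #|F|) ^+ t.
Proof.
apply: doeblin_tv => //; first by rewrite exprn_ge0 //= exprn_ile1.
move=> s s'; rewrite /two_step_kernel (bigD1 set0) //=.
apply: ler_wpDr.
  apply: sumr_ge0 => A _; rewrite !mulr_ge0 ?invr_ge0 //; first by rewrite ltW.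
  exact: sumr_ge0.
rewrite es_div_marginal ?sub0set //.
have cT t' : compat set0 t' by apply/compatP => f; rewrite inE.
have -> : ncompat q' (set0 : {set {set V}}) = #|{: config q V}|.
  by rewrite -cardsT; apply: eq_card => t'; rewrite !inE cT.
rewrite cT div1r ler_pM2r ?invr_gt0 ?ltr0n // es_set0 sum_es.
rewrite ler_pdivlMr ?weight_gt0 // ler_piMr ?exprn_ge0 //.
exact: weight_le1.
Qed.

Lemma sum_mu_centered_sqr (B : {set config q V}) :
  \sum_s w s * centered_ind mu B s ^+ 2 <= Z / 4.
Proof.
set m := \sum_(s in B) mu s.
have -> : \sum_s w s * centered_ind mu B s ^+ 2 =
    Z * \sum_s mu s * centered_ind mu B s ^+ 2.
  rewrite mulr_sumr; apply: eq_bigr => s _; rewrite muE; field; exact: lt0r_neq0.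
rewrite ler_pM2l //.
have -> : \sum_s mu s * centered_ind mu B s ^+ 2 =
    \sum_s (mu s * centered_ind mu B s * (1 - 2 * m)) + \sum_s mu s * (m - m ^+ 2).
  rewrite -big_split; apply: eq_bigr => s _ /=; rewrite /centered_ind -/m.
  by case: (s \in B); rewrite /=; ring.
rewrite -[X in X + _]mulr_suml -[X in _ + X]mulr_suml mu_sum.
rewrite (sum_mu_centered mu_sum) mul0r add0r mul1r.
have := sqr_ge0 (m - 2^-1).
have -> : (m - 2^-1) ^+ 2 = m ^+ 2 - m + 4^-1 by field.
lra.
Qed.

Lemma Z_le : Z <= q%:R ^+ #|V|.
Proof.
have -> : q%:R ^+ #|V| = \sum_(s : config q V) (1 : R).
  by rewrite sumr_const card_ffun card_ord natrX.
by apply: ler_sum => s _; apply: weight_le1.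
Qed.

(** Colouring all covered vertices with [ord0] leaves the others free. *)
Lemma ncompat_ge (A : {set {set V}}) : (q ^ (#|V| - #|cover A|) <= ncompat q' A)%N.
Proof.
have <- : #|pffun_on (ord0 : 'I_q) (mem (~: cover A)) predT| = (q ^ (#|V| - #|cover A|))%N.
  by rewrite card_pffun_on card_ord [#|~: _|]cardsCs setCK.
apply: subset_leq_card; apply/subsetP => s /pffun_onP[/subsetP H _].
rewrite inE; apply/compatP => f fA; apply/monochromaticP.
have K0 x : x \in f -> s x = ord0.
  move=> xf; apply/eqP; apply: contraT => nx; have := H x nx.
  by rewrite inE => /negP[]; apply/bigcupP; exists f.
by move=> x y /K0 -> /K0 ->.
Qed.

Section Covering.
Variable v : V.
Let psi (A : {set {set V}}) : R := (v \in cover A)%:R.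

(** Given [s] the bonds are independent, so the indicator that [v] is isolated factorises over the
    edges, and each edge at [v] is closed with probability at least [expR (- beta)]. *)
Lemma up_cover_le Delta s : (#|[set f in F | v \in f]| <= Delta)%N ->
  up es psi s <= 1 - r ^+ Delta.
Proof.
move=> HD; rewrite /up /wmean ler_pdivrMr // mulrBl mul1r.
have -> : \sum_A es s A * psi A =
    \sum_A es s A - \sum_A es s A * (v \notin cover A)%:R.
  rewrite -sumrB; apply: eq_bigr => A _; rewrite /psi.
  by case: (v \in cover A); rewrite /= ?mulr1 ?mulr0 ?subr0 ?subrr.
rewrite lerD2l lerN2.
have E A : es s A * (v \notin cover A)%:R =
    \prod_f (if f \in A then p * ((f \in F) && monochromatic s f)%:R * (v \notin f)%:R
             else if f \in F then r else 1).
  have [vA|vA] := boolP (v \in cover A).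
    case/bigcupP: vA => f fA vf.
    by rewrite mulr0 (bigD1 f) //= fA vf mulr0 mul0r.
  rewrite mulr1; apply: eq_bigr => f _; rewrite /es_factor; case: ifP => // fA.
  rewrite (_ : v \notin f) ?mulr1 //; apply: contra vA => vf.
  by apply/bigcupP; exists f.
under [X in _ <= X]eq_bigr => A _ do rewrite E.
rewrite sum_es -bigA_distr.
apply: (@le_trans _ _ (r ^+ #|[set f in F | v \in f]| * w s)).
  by rewrite ler_pM2r ?weight_gt0 // ler_wiXn2l.
rewrite -prodr_const /weight big_mkcond [X in _ * X]big_mkcond -big_split /=.
apply: ler_prod => f _; rewrite inE; case: (f \in F) => /=; last first.
  by rewrite mulr1 mulr0 mul0r add0r lexx ler01.
case: (v \in f); case: monochromatic;
  rewrite /= ?mulr0 ?mulr1 ?mul1r ?add0r ?subrK ?lexx ?ler01 ?r_ge0 ?andbT //.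
by rewrite mulr_ge0 //= ler_piMr.
Qed.

Lemma up_cover_union s :
  up es psi s <= \sum_(f in F | v \in f) p * (monochromatic s f)%:R.
Proof.
rewrite /up /wmean ler_pdivrMr // sum_es mulr_suml.
have E f : f \in F -> \sum_A es s A * (f \in A)%:R = p * (monochromatic s f)%:R * w s.
  move=> fF.
  have E A : es s A * (f \in A)%:R =
    \prod_g (if g \in A then p * ((g \in F) && monochromatic s g)%:R
             else if g == f then 0 else if g \in F then r else 1).
    have [fA|fA] := boolP (f \in A).
      rewrite mulr1; apply: eq_bigr => g _; rewrite /es_factor; case: ifP => // gA.
      by case: eqP => // gf; rewrite gf fA in gA.
    by rewrite mulr0 (bigD1 f) //= (negbTE fA) eqxx mul0r.
  under eq_bigr => A _ do rewrite E.
  rewrite -bigA_distr (bigD1 f) //= eqxx addr0 fF /=.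
  case mf : (monochromatic s f); last by rewrite mulr0 !mul0r.
  rewrite mulr1; congr (_ * _); rewrite /weight [in RHS](bigD1 f) //= mf mul1r.
  rewrite [RHS](eq_bigl (fun g => (g != f) && (g \in F))) => [|g]; last exact: andbC.
  rewrite big_mkcondr; apply: eq_bigr => g /negbTE ->.
  case: (g \in F) => /=; last by rewrite mulr0 add0r.
  by case: monochromatic; rewrite ?mulr1 ?mulr0 ?subrK ?add0r.
under [X in _ <= X]eq_bigr => f /andP[fF _] do rewrite -E //.
rewrite exchange_big /=; apply: ler_sum => A _; rewrite -mulr_sumr.
have [AF|/es_out ->] := boolP (A \subset F); last by rewrite !mul0r.
rewrite ler_wpM2l // /psi.
have [/bigcupP[f fA vf]|_] := boolP (v \in cover A); last exact: sumr_ge0.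
by rewrite (bigD1 f) ?(subsetP AF) ?vf //= fA lerDl sumr_ge0.
Qed.

(** Given the bonds, an isolated vertex has a uniform colour independent of all the others. *)
Lemma down_monochromatic_isolated (A : {set {set V}}) (u : V) :
  u != v -> v \notin cover A ->
  down es (fun s => (monochromatic s [set u; v])%:R) A <= q%:R^-1.
Proof.
move=> uv vA; have qi0 : 0 <= q%:R^-1 :> R by rewrite invr_ge0.
have [AF|/es_out H] := boolP (A \subset F); last first.
  by rewrite /down /wmean big1 ?mul0r // => s _; rewrite H mul0r.
have sep : separated A (~: [set v]).
  move=> g gA; left; apply/subsetP => x xg; rewrite !inE.
  by apply: contra vA => /eqP <-; apply/bigcupP; exists g.
have uW : u \in ~: [set v] by rewrite !inE.
have vW : v \notin ~: [set v] by rewrite !inE eqxx.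
rewrite /down /wmean mulr_suml.
under eq_bigr => s _ do rewrite mulrAC es_div_marginal // mulrAC.
rewrite -mulr_suml.
have n0 : 0 < (ncompat q' A)%:R :> R by rewrite ltr0n ncompat_gt0.
rewrite -(sum_compat_bridge R q' sep uW vW) invfM mulrC -mulrA ler_piMr //.
set S := \sum_(s : config q V) _.
by have [->|/mulVf ->] := eqVneq S 0; rewrite ?mulr0 ?ler01.
Qed.

Hypothesis irr : irreflexive e.

Lemma down_up_cover Delta A : (#|[set f in F | v \in f]| <= Delta)%N ->
  down es (up es psi) A <= (1 - r ^+ Delta) * psi A + beta * Delta%:R / q%:R.
Proof.
move=> HD; have b0 : 0 <= beta * Delta%:R / q%:R.
  by rewrite divr_ge0 // mulr_ge0 // ltW.
have a0 : 0 <= 1 - r ^+ Delta by rewrite subr_ge0 exprn_ile1.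
rewrite /psi; have [vA|vA] := boolP (v \in cover A).
  rewrite mulr1; apply: ler_wpDr => //; apply: wmean_le => // s.
  exact: up_cover_le.
rewrite mulr0 add0r.
apply: le_trans (le_wmean _ (up_cover_union)) _ => //.
rewrite wmean_sum; apply: (@le_trans _ _ (\sum_(f in F | v \in f) beta / q%:R)).
  apply: ler_sum => f /andP[fF vf]; rewrite wmeanZ; apply: ler_pM.
  - exact: ltW.
  - rewrite divr_ge0 ?sumr_ge0 // => s _; exact: mulr_ge0.
  - by rewrite lerBlDr -lerBlDl -[1 - _]/(1 + - beta) expR_ge1Dx.
  have [u uv ->] : exists2 u, u != v & f = [set u; v].
    move: vf; have /edgesP[x [y [exy ->]]] := fF.
    have xy : x != y by apply: contraTneq exy => ->; rewrite irr.
    by rewrite !inE => /orP[]/eqP ->; [exists y; rewrite 1?eq_sym // setUC|exists x].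
  exact: down_monochromatic_isolated.
rewrite (eq_bigl (mem [set f in F | v \in f])) => [|f]; last by rewrite /= inE.
rewrite sumr_const -[_ *+ _]mulr_natr mulrAC ler_pM2r ?invr_gt0 ?ltr0n //.
by rewrite ler_pM2l // ler_nat.
Qed.
End Covering.

Section BurnIn.
Variables (gap j c : R) (Delta : nat).
Hypotheses (irr : irreflexive e) (gap01 : 0 <= gap <= 1) (Fgap : es_gap beta q' F gap).
Hypotheses (j0 : 0 < j) (c0 : 0 <= c).
Hypothesis cj : c = 1 \/ j * c = ln q%:R.
Hypothesis degF : forall v, (#|[set f in F | v \in f]| <= Delta)%N.

Let q_gt0 : 0 < q%:R :> R. Proof. by rewrite ltr0n. Qed.
Let lnq_ge0 : 0 <= ln q%:R :> R. Proof. by rewrite ln_ge0 // ler1n. Qed.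

(* A bond configuration with few covered vertices is an L2-warm start; for the
   other ones the trivial bound 1 is at most [c * #|cover A|]. *)
Lemma down_warm_start (B : {set config q V}) s (A : {set {set V}}) :
  `|down es (iter s (up es \o down es) (centered_ind mu B)) A| <=
  2^-1 * (1 - gap) ^+ s * expR ((beta * #|F|%:R + j) / 2) + c * #|cover A|%:R.
Proof.
case/andP: gap01 => gap0 gap1.
set phi := iter s _ _; set C := 2^-1 * _ * _.
have g1 : 0 <= 1 - gap by rewrite subr_ge0.
have C0 : 0 <= C by rewrite mulr_ge0 ?expR_ge0 // mulr_ge0 ?invr_ge0 //; exact: exprn_ge0.
have [AF|/es_out H] := boolP (A \subset F); last first.
  rewrite (_ : down _ _ _ = 0) ?normr0; first by rewrite addr_ge0 // mulr_ge0.
  by rewrite /down /wmean big1 ?mul0r // => t _; rewrite H mul0r.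
have [small|large] := leP (#|cover A|%:R * ln q%:R) j; last first.
  apply: ler_wpDl => //; apply: (@le_trans _ _ 1).
    apply: le_trans (norm_wmean _ _) _ => //; apply: wmean_le => // t.
    rewrite /phi -iter_two_step; apply: iter_markov_op_le1 => // z.
    exact: centered_ind_le1.
  (* If [c = 1], one covered vertex is enough, and there is one because [j > 0]; otherwise
     [c = ln q / j] and [large] says exactly that [c * #|cover A| > 1]. *)
  case: cj => [->|cE].
    rewrite mul1r ler1n lt0n; apply/negP => /eqP E0.
    by move: large; rewrite E0 mul0r ltNge ltW.
  by rewrite -(ler_pM2l j0) mulrA cE mulr1 mulrC ltW.
apply: ler_wpDr; first by rewrite mulr_ge0.
rewrite -ler_sqr ?nnegrE // real_normK ?num_real //.
(* The law given [A] is uniform on [ncompat q' A] configurations, each of weight at least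
   [r ^+ #|F|]. *)
pose M : R := (r ^+ #|F|)^-1 / (ncompat q' A)%:R.
have nA : 0 < (ncompat q' A)%:R :> R by rewrite ltr0n ncompat_gt0.
have rF : 0 < r ^+ #|F| by rewrite exprn_gt0.
have M0 : 0 <= M by rewrite divr_ge0 ?invr_ge0 // ltW.
have hM : forall t, es t A / \sum_t' es t' A <= M * \sum_A' es t A'.
  move=> t; rewrite es_div_marginal // sum_es /M mulrAC ler_pM2r ?invr_gt0 //.
  rewrite mulrC ler_pdivlMr //; apply: le_trans (weight_ge beta0 F t).
  by rewrite ler_piMl ?(ltW rF) //; case: compat; rewrite ?ler01.
apply: le_trans (down_sqr_le es_nonneg phi hM) _.
have mean0 : \sum_t (\sum_A' es t A') * centered_ind mu B t = 0.
  have := sum_mu_centered mu_sum B; under eq_bigr => t _ do rewrite muE mulrAC.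
  rewrite -mulr_suml => /eqP; rewrite mulf_eq0 invr_eq0 (gt_eqF Z_gt0) orbF => /eqP E.
  by rewrite -[RHS]E; apply: eq_bigr => t _; rewrite sum_es.
have [_ contr] := two_step_contract_iter es_nonneg gap1 Fgap s mean0.
apply: le_trans (ler_wpM2l M0 contr) _.
have hB : \sum_t (\sum_A' es t A') * centered_ind mu B t ^+ 2 <= q%:R ^+ #|V| / 4.
  under eq_bigr => t _ do rewrite sum_es.
  apply: le_trans (sum_mu_centered_sqr B) _.
  by rewrite ler_pM2r ?invr_gt0 // Z_le.
have g2 : 0 <= (1 - gap) ^+ (2 * s) by exact: exprn_ge0.
apply: le_trans (ler_wpM2l M0 (ler_wpM2l g2 hB)) _.
have -> : C ^+ 2 = (1 - gap) ^+ (2 * s) * (expR (beta * #|F|%:R) * expR j / 4).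
  rewrite /C !exprMn -exprM mulnC -expRD -[expR _ ^+ 2]expRM_natl.
  have -> : 2%:R * ((beta * #|F|%:R + j) / 2) = beta * #|F|%:R + j by field.
  by rewrite expr2; field.
rewrite mulrCA ler_wpM2l // mulrA ler_pM2r ?invr_gt0 //.
rewrite /M -expRM_natl -expRN.
have -> : - (#|F|%:R * - beta) = beta * #|F|%:R by ring.
rewrite -mulrA ler_pM2l ?expR_gt0 //.
(* The factor [q ^ #|V|] from the partition function cancels against the free colours in [ncompat];
   what is left is at most [expR j] by [small]. *)
apply: (@le_trans _ _ (q%:R ^+ #|cover A|)); last first.
  rewrite -[q%:R]lnK ?posrE // -expRM_natl ler_expR //.
rewrite mulrC ler_pdivrMr // -natrX -natrX -natrM ler_nat.
apply: leq_trans (leq_mul (leqnn _) (ncompat_ge A)).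
by rewrite -expnD subnKC // max_card.
Qed.

Lemma SW_tv_le s t :
  tv_dist K mu (t.+1 + s) <=
  2^-1 * (1 - gap) ^+ s * expR ((beta * #|F|%:R + j) / 2) +
  c * (#|V|%:R * ((1 - r ^+ Delta) ^+ t.+1 + beta * Delta%:R / q%:R / r ^+ Delta)).
Proof.
case/andP: gap01 => gap0 gap1.
set C := 2^-1 * _ * _.
have g1 : 0 <= 1 - gap by rewrite subr_ge0.
have C0 : 0 <= C by rewrite mulr_ge0 ?expR_ge0 // mulr_ge0 ?invr_ge0 //; exact: exprn_ge0.
have rD : 0 < r ^+ Delta by rewrite exprn_gt0.
have rD1 : r ^+ Delta <= 1 by rewrite exprn_ile1.
have b0 : 0 <= beta * Delta%:R / q%:R by rewrite divr_ge0 // mulr_ge0 // ltW.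
apply: tv_dist_le => //.
  apply: addr_ge0 => //; apply: mulr_ge0 => //; apply: mulr_ge0 => //.
  by apply: addr_ge0; rewrite ?exprn_ge0 ?subr_ge0 // divr_ge0 // ltW.
move=> x B; rewrite iter_two_step iterD iter_up_down.
pose psi v (A : {set {set V}}) : R := (v \in cover A)%:R.
(* Averaging preserves a bound that is affine in the covering indicators, so the drift can be
   applied to each vertex separately. *)
have L (T : finType) (u f : T -> R) (g : V -> T -> R) : (forall z, 0 <= u z) ->
    (forall z, f z <= c * \sum_v g v z + C) ->
    wmean u f <= c * \sum_v wmean u (g v) + C.
  move=> u0 fg; apply: le_trans (le_wmean u0 fg) _.
  by apply: le_trans (wmean_affine _ _ u0 C0) _; rewrite wmean_sum.
apply: le_trans (norm_up_iter es_nonneg t (psi := fun A => c * \sum_v psi v A + C) _ x) _.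
  move=> A; have -> : \sum_v psi v A = #|cover A|%:R.
    rewrite -sum1_card natr_sum [RHS]big_mkcond; apply: eq_bigr => v _.
    by rewrite /psi; case: (v \in _).
  by rewrite addrC; apply: down_warm_start.
have H y : iter t (down es \o up es) (fun A => c * \sum_v psi v A + C) y <=
    c * \sum_v iter t (down es \o up es) (psi v) y + C.
  elim: (t) y => // k IH y /=; apply: (L) => // z; exact: L.
apply: le_trans (L _ _ _ _ _ H) _ => //.
rewrite addrC lerD2l ler_wpM2l //.
rewrite mulr_natl -sumr_const; apply: ler_sum => v _.
rewrite -[in X in _ <= _ + _ / X](subKr 1 (r ^+ Delta)).
apply: up_iter_le => //.
- by rewrite subr_ge0 rD1 /= gtrBl.
- by move=> z; apply: up_cover_le.
- by move=> A; apply: down_up_cover.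
Qed.

End BurnIn.
End Mixing.

(** * Elementary numerical inequalities *)

Section Numeric.
Variable R : realType.
Implicit Types x y : R.

Lemma expR1_ge : 5 / 2 <= expR 1 :> R.
Proof.
have h : 9 / 8 <= expR (8%:R^-1) :> R.
  by apply: le_trans (expR_ge1Dx _); lra.
rewrite -[X in expR X](@divff _ (8%:R : R)) // expRM_natl; apply: le_trans (lerXn2r 8 _ _ h); rewrite ?nnegrE ?expR_ge0 //;
  lra.
Qed.

Lemma expR1_le : expR 1 <= 3 :> R.
Proof.
have h : 7 / 8 <= expR (- 8%:R^-1) :> R.
  by apply: le_trans (expR_ge1Dx _); lra.
have -> : expR 1 = (expR (- 8%:R^-1) ^+ 8)^-1 :> R.
  by rewrite -expRM_natl -expRN mulrN opprK divff.
rewrite -[3]invrK lef_pV2 ?posrE ?exprn_gt0 ?expR_gt0 //.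
by apply: le_trans (lerXn2r 8 _ _ h); rewrite ?nnegrE ?expR_ge0 //; lra.
Qed.

Lemma ln2_ge : 3 / 5 <= ln 2 :> R.
Proof.
rewrite -ler_expR lnK ?posrE //.
(* Fifth powers reduce the claim to [e^3 <= 27 <= 32]. *)
rewrite -(@ler_pXn2r _ 5) ?nnegrE ?expR_ge0 //.
rewrite -expRM_natl; have -> : 5%:R * (3 / 5) = 3%:R * 1 :> R by field.
rewrite expRM_natl; apply: le_trans (lerXn2r 3 _ _ expR1_le) _;
  rewrite ?nnegrE ?expR_ge0 //; lra.
Qed.

Lemma mulr_expRN_le x : x * expR (- x) <= expR (- 1).
Proof.
rewrite expRN ler_pdivrMr ?expR_gt0 // -expRD.
by have := expR_ge1Dx (-1 + x); lra.
Qed.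

Lemma onem_expn_le x t : 0 <= x <= 1 -> (1 - x) ^+ t <= expR (- (x * t%:R)).
Proof.
case/andP=> x0 x1.
have -> : - (x * t%:R) = t%:R * - x by ring.
rewrite expRM_natl; apply: lerXn2r; rewrite ?nnegrE ?expR_ge0 ?subr_ge0 //.
exact: expR_ge1Dx.
Qed.

Lemma truncnS_bounds x : 0 <= x -> x <= (Num.truncn x).+1%:R <= x + 1.
Proof.
move=> x0; have /andP[h1 h2] := truncn_itv x0.
by rewrite ltW //= -natr1 lerD2r.
Qed.

(** The tangent at [e^3] gives [ln x <= x / e^3 + 2]. With [e >= 5/2] and [ln 2 >= 3/5] it is enough
    that [8 <= (9/20 - 8/125) x], which holds from 21 on: hence the threshold of 20 vertices. In the
    step count of [SW_mixing_time_gap], 3/20 is half the factor in [j], and 6 is 4 + 2 plus two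
    roundings minus the 2 of the bound. *)
Lemma ln_le_linear x : 21 <= x -> ln x + 6 <= (ln 2 - 3 / 20) * x.
Proof.
move=> x21; have x0 : 0 < x by lra.
have := expR_ge1Dx (ln x - 3); rewrite expRD lnK ?posrE //.
have -> : - 3 = - (3%:R * 1) :> R by rewrite mulr1.
rewrite expRN expRM_natl => h.
have h2 : x / expR 1 ^+ 3 <= x / (5 / 2) ^+ 3.
  by rewrite ler_pM2l // lef_pV2 ?posrE ?exprn_gt0 ?expR_gt0 // ?lerXn2r ?nnegrE
    ?expR_ge0 ?expR1_ge //; lra.
have := ln2_ge; nra.
Qed.

End Numeric.

(** * Mixing times from the Doeblin condition and from the gap *)

Section MixingTime.
Variables (R : realType) (beta : R) (q' : nat) (V : finType) (e : rel V).
Hypothesis beta0 : 0 < beta.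
Local Notation q := q'.+1.
Local Notation F := (edges e).
Local Notation n := (#|V|%:R : R).

Lemma expR_pow (m : nat) : expR (- beta) ^+ m = expR (- (beta * m%:R)).
Proof. by rewrite -expRM_natl mulrN mulrC. Qed.

Theorem SW_mixing_time_doeblin (K D : R) : (0 < #|V|)%N -> 0 <= D ->
  #|F|%:R <= K ->
  (SW_mixing_time beta q e <= (expR (beta * K) * (2 + (ln 2 + D * beta) * n))%:E)%E.
Proof.
move=> V0 D0 FK; rewrite SW_mixing_timeE //.
have ln20 : 0 <= ln 2 :> R by apply: le_trans (ln2_ge R).
set a := expR (beta * #|F|%:R).
have a1 : 1 <= a by rewrite -expR0 ler_expR mulr_ge0 // ltW.
have aK : a <= expR (beta * K) by rewrite ler_expR ler_pM2l.
(* The target [1 / (2e)] is [expR (- (1 + ln 2))], and each step gains a factor [expR (- a^-1)].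
   Rounding up costs 1, at most [a]. *)
have /andP[t1 t2] : a * (1 + ln 2) <= (Num.truncn (a * (1 + ln 2))).+1%:R
    <= a * (1 + ln 2) + 1.
  by apply: truncnS_bounds; rewrite mulr_ge0 //; lra.
apply: (@mixing_time_le _ _ _ _ (Num.truncn (a * (1 + ln 2))).+1); last first.
  apply: (le_trans t2).
  have n1 : 1 <= n by rewrite ler1n.
  have Dn : 0 <= D * beta * n by rewrite !mulr_ge0 // ltW.
  have ln2n : ln 2 <= ln 2 * n by rewrite ler_peMr.
  apply: (@le_trans _ _ (a * (2 + ln 2))); first nra.
  by apply: ler_pM; lra.
apply: le_trans (SW_doeblin q' e beta0 _) _; rewrite expR_pow.
apply: le_trans (onem_expn_le _ _) _.
  by rewrite expR_ge0 /= -expR0 ler_expR oppr_le0 mulr_ge0 // ltW.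
have -> : (2 * expR 1)^-1 = expR (- (1 + ln 2)) :> R.
  by rewrite expRN expRD lnK ?posrE // mulrC.
rewrite ler_expR lerN2 expRN mulrC ler_pdivlMr ?expR_gt0 //.
by rewrite mulrC.
Qed.

(** The terms are the L2 error, the burn-in error and the contribution of vertices that stay covered
    after the burn-in. *)
Lemma error_sum_le : expR (- 2) / 2 + expR (- 4) + expR (- 1) ^+ 2 / (12 / 5) <=
  (2 * expR 1)^-1 :> R.
Proof.
have E k : expR (- k%:R) = (expR 1 ^+ k)^-1 :> R by rewrite -expRM_natl mulr1 expRN.
rewrite (E 2%N) (E 4%N) (E 1%N) expr1.
have := @expR1_ge R; set x := expR 1 => x52.
have x0 : 0 < x by lra.
have xn0 : x != 0 by rewrite lt0r_neq0.
rewrite -subr_ge0.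
have -> : (2 * x)^-1 - ((x ^+ 2)^-1 / 2 + (x ^+ 4)^-1 + x^-1 ^+ 2 / (12 / 5)) =
  (x ^+ 3 / 2 - x ^+ 2 / 2 - 1 - x ^+ 2 * (5 / 12)) / x ^+ 4 by field.
apply: divr_ge0; last by rewrite exprn_ge0 // ltW.
nra.
Qed.

(* [t.+1] burn-in steps are followed by [s] steps of L2 contraction. The two
   parts of the expected number of covered vertices contribute at most
   [expR (- 4)] and, by two uses of [u e^-u <= 1/e], [e^-2 / (12 / 5)]. *)
Theorem SW_mixing_time_gap (kappa K D : R) (Delta : nat) : irreflexive e ->
  (21 <= #|V|)%N -> 0 <= kappa -> es_gap beta q' F (expR (- (beta * kappa))) ->
  (forall v, (#|[set f in F | v \in f]| <= Delta)%N) ->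
  #|F|%:R <= D * n -> kappa + 9 * Delta%:R <= K ->
  (SW_mixing_time beta q e <= (expR (beta * K) * (2 + (ln 2 + D * beta) * n))%:E)%E.
Proof.
move=> irr V21 kappa0 Fgap degF FD hK; rewrite SW_mixing_timeE //.
have n21 : 21 <= n by rewrite ler_nat.
set z := beta * kappa; have z0 : 0 <= z by rewrite mulr_ge0 // ltW.
set y := beta * Delta%:R; have y0 : 0 <= y by rewrite mulr_ge0 // ltW.
set m : R := #|F|%:R in FD *; have m0 : 0 <= m by rewrite ler0n.
pose b := expR (9 * y); pose a := expR z.
have b1 : 1 <= b by rewrite -expR0 ler_expR; lra.
have yb : expR y <= b by rewrite ler_expR; lra.
have a1 : 1 <= a by rewrite -expR0 ler_expR.
have abK : a * b <= expR (beta * K).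
  rewrite -expRD ler_expR; apply: le_trans (ler_wpM2l (ltW beta0) hK).
  by rewrite /z /y; lra.
(* In [b = expR (9 * y)] one [y] pays for the factor [expR y] of the drift bound, and the other
   eight leave [8 * y * expR (- (8 * y))], at most 1/e. The constants combine to
   [3/10 * 8 = 12/5]. *)
pose j := 3 / 10 * n * b; have j0 : 0 < j by rewrite !mulr_gt0 // ?expR_gt0 //; lra.
have lnq0 : 0 <= ln q%:R :> R by rewrite ln_ge0 // ler1n.
have [c [c0 c1 cj cjq]] : exists c : R,
    [/\ 0 <= c, c <= 1, c = 1 \/ j * c = ln q%:R & c <= ln q%:R / j].
  have [h|h] := leP 1 (ln q%:R / j); first by exists 1; split => //; left.
  exists (ln q%:R / j); split; rewrite ?divr_ge0 // ?ltW //.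
  by right; rewrite mulrC divfK // lt0r_neq0.
(* [T] burn-in steps bring the transient part, summed over [n] vertices, below [expR (- 4)]; [S]
   steps cancel the warm-start factor [expR ((beta * m + j) / 2)] and leave [expR (- 2)]. *)
pose T := expR y * (ln n + 4); pose S := a * (2 + (beta * m + j) / 2).
have lnn0 : 0 <= ln n by rewrite ln_ge0 //; lra.
have T0 : 0 <= T by rewrite mulr_ge0 ?expR_ge0 //; lra.
have bm0 : 0 <= beta * m by rewrite mulr_ge0 // ltW.
have S0 : 0 <= S by rewrite mulr_ge0 ?expR_ge0 //; lra.
have /andP[t1 t2] := truncnS_bounds T0; have /andP[s1 s2] := truncnS_bounds S0.
set t := Num.truncn T in t1 t2; set s := (Num.truncn S).+1 in s1 s2.
have ab1 : a <= a * b by rewrite ler_peMr //; lra.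
have ab2 : b <= a * b by rewrite ler_peMl //; lra.
apply: (@mixing_time_le _ _ _ _ (t.+1 + s)); last first.
  rewrite natrD; apply: (le_trans (lerD t2 s2)).
  have D0 : 0 <= D * beta * n.
    rewrite mulrAC mulrC mulr_ge0 ?(ltW beta0) //; exact: le_trans m0 FD.
  apply: (@le_trans _ _ (a * b * (2 + (ln 2 + D * beta) * n))); last first.
    rewrite ler_wpM2r //; have := @ln2_ge R; nra.
  have lnn := ln_le_linear n21.
  have Dm : beta * m <= D * beta * n.
    have -> : D * beta * n = beta * (D * n) by ring.
    by rewrite ler_pM2l.
  set X := D * beta * n in D0 Dm *.
  have -> : (ln 2 + D * beta) * n = ln 2 * n + X by rewrite mulrDl.
  have T1 : T <= a * b * (ln n + 4) by rewrite ler_wpM2r ?(le_trans yb) //; lra.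
  have S1 : S <= a * b * (2 + X / 2 + 3 / 20 * n).
    have -> : S = a * (2 + beta * m / 2) + a * b * (3 / 20 * n).
      by rewrite /S /j; field.
    have : a * (2 + beta * m / 2) <= a * b * (2 + X / 2) by apply: ler_pM; lra.
    by lra.
  have ab0 : 1 <= a * b by lra.
  have : a * b * (ln n + 4 + 2 + X / 2 + 3 / 20 * n + 2) <= a * b * (2 + (ln 2 * n + X)).
    by apply: ler_wpM2l; lra.
  nra.
apply: le_trans (error_sum_le).
have gap01 : 0 <= expR (- z) <= 1.
  by rewrite expR_ge0 /= -expR0 ler_expR oppr_le0.
apply: le_trans (SW_tv_le beta0 irr gap01 Fgap j0 c0 cj degF s t) _.
set E1 := 2^-1 * _ * _.
have h1 : E1 <= expR (- 2) / 2.
  rewrite /E1 -mulrA mulrC ler_pM2r //.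
  apply: (@le_trans _ _ (expR (- (2 + (beta * m + j) / 2)) * expR ((beta * m + j) / 2))).
    apply: ler_wpM2r; first exact: expR_ge0.
    apply: le_trans (onem_expn_le _ gap01) _; rewrite ler_expR lerN2 expRN.
    by rewrite [leRHS]mulrC ler_pdivlMr ?expR_gt0 // mulrC.
  by rewrite -expRD ler_expR; lra.
rewrite expR_pow -/y -addrA lerD //.
rewrite !mulrDr; apply: lerD.
  apply: (@le_trans _ _ (n * (1 - expR (- y)) ^+ t.+1)).
    rewrite ler_piMl // mulr_ge0 // exprn_ge0 // subr_ge0 -expR0 ler_expR; lra.
  apply: (@le_trans _ _ (expR (ln n) * expR (- (ln n + 4)))); last first.
    by rewrite -expRD ler_expR; lra.
  rewrite lnK ?posrE; last lra.
  rewrite ler_pM2l; last lra.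
  apply: le_trans (onem_expn_le _ _) _.
    by rewrite expR_ge0 /= -expR0 ler_expR; lra.
  rewrite ler_expR lerN2 expRN mulrC ler_pdivlMr ?expR_gt0 // mulrC.
  exact: t1.
apply: (@le_trans _ _ (ln q%:R / j * (n * (y / q%:R * expR y)))).
  rewrite expRN invrK; apply: ler_wpM2r => //.
  by rewrite mulr_ge0 // mulr_ge0 ?expR_ge0 // divr_ge0.
have -> : ln q%:R / j * (n * (y / q%:R * expR y)) =
    ln q%:R * expR (- ln q%:R) * (8 * y * expR (- (8 * y))) / (12 / 5).
  have bE : b = expR y * expR (8 * y) by rewrite -expRD; congr expR; ring.
  rewrite /j bE !expRN lnK ?posrE ?ltr0n //; field.
  by rewrite !lt0r_neq0 ?expR_gt0 ?(lt_le_trans _ n21) // ltr_pwDl.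
rewrite ler_pM2r; last lra.
rewrite expr2; apply: ler_pM; rewrite ?mulr_expRN_le // mulr_ge0 ?expR_ge0 //.
by rewrite mulr_ge0.
Qed.

End MixingTime.

(** * Forests, grids and tori *)

Section Forest.
Variables (R : realType) (beta : R) (q' : nat) (V : finType).
Hypothesis beta0 : 0 < beta.
Implicit Types F : {set {set V}}.

(** Every edge is a bridge, [W] being one side of a cut crossed by [f] alone. This form passes to
    subsets and is what [es_gap_bridge] consumes. *)
Definition forest F : Prop := forall f, f \in F -> exists u v (W : {set V}),
  [/\ f = [set u; v], u \in W, v \notin W & separated (F :\ f) W].

Lemma forest_sub F F' : F' \subset F -> forest F -> forest F'.
Proof.
move=> /subsetP sF fF f fF'; have [u [v [W [E uW vW sep]]]] := fF f (sF _ fF').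
exists u, v, W; split=> // g; rewrite in_setD1 => /andP[gf gF'].
by apply: sep; rewrite in_setD1 gf sF.
Qed.

Lemma es_gap_forest F : forest F -> es_gap beta q' F (expR (- beta)).
Proof.
elim: {F}_.+1 {-2}F (ltnSn #|F|) => // k IH F Fk fF.
have [->|[f fF']] := set_0Vmem F.
  refine (es_gap_weaken beta0 (ltW (expRN_lt1 beta0)) (es_gap_set0 beta0)).
have [u [v [W [E uW vW sep]]]] := fF f fF'.
rewrite -(setD1K fF') {1}E.
apply: (es_gap_bridge beta0 sep uW vW) => //.
apply: IH; first by move: Fk; rewrite (cardsD1 f) fF'.
by apply: forest_sub fF; apply: subD1set.
Qed.

(** With two colours, each edge of a forest halves the number of compatible configurations, which
    starts at [2 ^ #|V|] and never drops below 1. *)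
Lemma card_forest F : forest F -> (#|F| <= #|V|)%N.
Proof.
pose nc (A : {set {set V}}) := @ncompat 1 V A.
suff H k : forall F, #|F| = k -> forest F -> (nc F * 2 ^ k = 2 ^ #|V|)%N.
  move=> fF; rewrite -(leq_exp2l (m := 2)) // -(H _ _ erefl fF).
  by rewrite leq_pmull // ncompat_gt0.
elim: k => [|k IH] {}F Fk fF.
  move/eqP: Fk; rewrite cards_eq0 => /eqP ->; rewrite muln1.
  transitivity #|{: config 2 V}|; last by rewrite card_ffun card_ord.
  by rewrite -cardsT; apply: eq_card => s; rewrite !inE; apply/compatP => f; rewrite inE.
have [f fF'] : exists f, f \in F by apply/card_gt0P; rewrite Fk.
have [u [v [W [E uW vW sep]]]] := fF f fF'.
have Fk' : #|F :\ f| = k by move: Fk; rewrite (cardsD1 f) fF' => -[].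
rewrite -(IH (F :\ f)) //; last by apply: forest_sub fF; apply: subD1set.
rewrite expnS mulnA; congr (_ * _)%N.
apply/eqP; rewrite -(eqr_nat R) natrM /nc -(sum_compat_bridge R 1 sep uW vW).
rewrite mulrC -sum_compat; apply/eqP; congr (_ * _); apply: eq_bigr => s _.
rewrite -natrM mulnb; congr ((nat_of_bool _)%:R); rewrite -E.
apply/compatP/andP => [H|[/compatP H mf] g gF].
  split; last exact: H; apply/compatP => g; rewrite in_setD1 => /andP[_].
  exact: H.
by have [->//|gf] := eqVneq g f; apply: H; rewrite in_setD1 gf.
Qed.

End Forest.

Section Counting.

(** The code is a relation, so that it has to be built only for members of [S], where the bounds
    needed for ordinals are available. *)
Lemma card_le_functional (T K : finType) (S : {set T}) (r : T -> K -> Prop) :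
  (forall t, t \in S -> exists k, r t k) ->
  (forall t t' k, t \in S -> t' \in S -> r t k -> r t' k -> t = t') ->
  (#|S| <= #|K|)%N.
Proof.
move=> ex inj; have [->|[t0 t0S]] := set_0Vmem S; first by rewrite cards0.
have [k0 _] := cid (ex _ t0S).
have /choice[f Hf] : forall t, exists k, t \in S -> r t k.
  move=> t; have [/ex[k rk]|nt] := boolP (t \in S); first by exists k.
  by exists k0.
rewrite -(card_in_imset (f := f)) ?max_card // => t t' tS t'S E.
apply: (inj _ _ (f t) tS t'S); first exact: Hf.
by rewrite E; apply: Hf.
Qed.

Lemma card_dffun_prod (I : finType) (s : I -> nat) :
  #|{dffun forall i, 'I_(s i)}| = (\prod_i s i)%N.
Proof.
rewrite card_dep_ffun foldrE big_map big_enum /=.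
by apply: eq_bigr => i _; rewrite card_ord.
Qed.

Variables (V : finType) (e : rel V).

Lemma card_edges_at Delta v : symmetric e ->
  (#|[set y | e v y]| <= Delta)%N ->
  (#|[set f in edges e | v \in f]| <= Delta)%N.
Proof.
move=> sym; apply: leq_trans.
apply: leq_trans (leq_imset_card (fun y => [set v; y]) _).
apply: subset_leq_card; apply/subsetP => f; rewrite inE => /andP[/edgesP[x [y [exy ->]]]].
rewrite !inE => /orP[]/eqP ->.
  by apply/imsetP; exists y; rewrite ?inE.
by apply/imsetP; exists x; rewrite ?inE 1?sym // setUC.
Qed.

Lemma card_edges_le Delta : (forall v, #|[set y | e v y]| <= Delta)%N ->
  (#|edges e| <= #|V| * Delta)%N.
Proof.
move=> H; apply: leq_trans (leq_imset_card _ _) _.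
rewrite -sum1_card (eq_bigl (fun p => true && e p.1 p.2)) => [|p]; last by rewrite inE.
rewrite -(pair_big_dep xpredT e (fun _ _ => 1%N)) /=.
apply: (@leq_trans (\sum_(v : V) Delta)); last by rewrite sum_nat_const.
apply: leq_sum => v _; rewrite sum1_card; apply: leq_trans (H v).
by apply/eq_leq/eq_card => y; rewrite inE.
Qed.

End Counting.

(** * Recursive bisection, for boxes ([cutwidth] 1) and tori ([cutwidth] 2) alike *)

Section Grid.
Variables (V : finType) (e : rel V).
Variables (d : nat) (pos : V -> 'I_d -> nat) (adj : rel nat) (cutwidth : nat).
Hypothesis pos_inj : forall x y, pos x =1 pos y -> x = y.
Hypotheses (adj_sym : symmetric adj) (adj_irr : irreflexive adj).
Hypothesis e_pos : forall x y, e x y -> exists i,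
  adj (pos x i) (pos y i) /\ forall j, j != i -> pos x j = pos y j.
Hypothesis adj_cut : forall c, exists ps : seq (nat * nat),
  (size ps <= cutwidth)%N /\ forall a b, adj a b -> (a < c <= b)%N -> (a, b) \in ps.
Implicit Types a s : 'I_d -> nat.

Definition subbox a s : {set V} :=
  [set x | [forall i, a i <= pos x i < a i + s i]%N].

Definition box_edges a s : {set {set V}} :=
  [set f in edges e | f \subset subbox a s].

Definition upd a (i : 'I_d) (k : nat) (j : 'I_d) : nat := if j == i then k else a j.

Lemma prod_upd s i k : (\prod_j upd s i k j = \prod_j upd s i 1 j * k)%N.
Proof.
rewrite (bigD1 i) //= [in RHS](bigD1 i) //= {1 3}/upd eqxx mul1n mulnC.
by congr (_ * _)%N; apply: eq_bigr => j /negbTE ji; rewrite /upd ji.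
Qed.

Lemma card_subbox a s : (#|subbox a s| <= \prod_i s i)%N.
Proof.
rewrite -card_dffun_prod.
apply: (card_le_functional
  (r := fun x (g : {dffun forall i, 'I_(s i)}) => forall i, pos x i = (a i + g i)%N)).
  move=> x; rewrite inE => /forallP H.
  have h i : (pos x i - a i < s i)%N by have := H i; lia.
  exists (finfun (fun i => Ordinal (h i))) => i; rewrite ffunE /=.
  by have := H i; lia.
by move=> x y g _ _ Hx Hy; apply: pos_inj => i; rewrite Hx Hy.
Qed.

(** A crossing edge is determined by the pair of its [i]-th coordinates, one of at most [cutwidth],
    and by the other coordinates, which its ends share; [upd s i 1] makes the factor for direction
    [i] trivial. *)
Lemma subbox_cut_card a s i c :
  (#|[set f in box_edges a s | ~~ (f \subset subbox a (upd s i (c - a i)))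
      && ~~ (f \subset subbox (upd a i c) (upd s i (a i + s i - c)))]|
   <= cutwidth * \prod_j upd s i 1 j)%N.
Proof.
have [ps [ps_size Hps]] := adj_cut c.
rewrite -card_dffun_prod -[cutwidth]card_ord -card_prod.
apply: (card_le_functional (r := fun f (kg : 'I_cutwidth * {dffun forall j, 'I_(upd s i 1 j)}) =>
  exists x y, [/\ f = [set x; y], pos x i = (nth (0, 0) ps kg.1).1%N,
    pos y i = (nth (0, 0) ps kg.1).2%N
    & forall j, j != i -> pos x j = (a j + kg.2 j)%N /\ pos y j = (a j + kg.2 j)%N])).
- move=> f; rewrite !inE => /andP[/andP[/edgesP[x [y [exy ->]]] fb] /andP[nlo nup]].
  have [i' [axy xyE]] := e_pos exy.
  have /subsetP fbox := fb.
  have xb : x \in subbox a s by apply: fbox; rewrite !inE eqxx.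
  have yb : y \in subbox a s by apply: fbox; rewrite !inE eqxx orbT.
  have lo z : z \in subbox a s -> (pos z i < c)%N ->
      z \in subbox a (upd s i (c - a i)).
    rewrite !inE => /forallP H zc; apply/forallP => j; have := H j.
    by rewrite /upd; case: eqP => [->|_] //; lia.
  have up z : z \in subbox a s -> (c <= pos z i)%N ->
      z \in subbox (upd a i c) (upd s i (a i + s i - c)).
    rewrite !inE => /forallP H zc; apply/forallP => j; have := H j.
    by rewrite /upd; case: eqP => [->|_] //; lia.
  have main x' y' : x' \in subbox a s -> adj (pos x' i) (pos y' i) ->
      (forall j, j != i -> pos x' j = pos y' j) ->
      (pos x' i < c <= pos y' i)%N ->
      exists kg : 'I_cutwidth * {dffun forall j, 'I_(upd s i 1 j)},
      exists x y, [/\ [set x'; y'] = [set x; y], pos x i = (nth (0, 0) ps kg.1).1%N,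
        pos y i = (nth (0, 0) ps kg.1).2%N
        & forall j, j != i -> pos x j = (a j + kg.2 j)%N /\ pos y j = (a j + kg.2 j)%N].
    move=> x'b axy' E' cxy; have pin := Hps _ _ axy' cxy.
    have kl : (index (pos x' i, pos y' i) ps < cutwidth)%N.
      by apply: leq_trans ps_size; rewrite index_mem.
    have hj j : ((if j == i then 0 else pos x' j - a j) < upd s i 1 j)%N.
      rewrite /upd; case: eqP => // _; move: x'b; rewrite inE => /forallP/(_ j); lia.
    exists (Ordinal kl, finfun (fun j => Ordinal (hj j))), x', y'.
    split=> //=; rewrite ?nth_index // => j ji; rewrite !ffunE /= -E' // (negbTE ji).
    by move: x'b; rewrite inE => /forallP/(_ j); lia.
  have [xc|xc] := ltnP (pos x i) c.
    have yc : (c <= pos y i)%N.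
      rewrite leqNgt; apply: contra nlo => yc; apply/subsetP => z.
      by rewrite in_set2 => /orP[]/eqP ->; apply: lo.
    have ii : i' = i.
      by apply/eqP; apply: contraT => ii; have := xyE i; rewrite eq_sym ii; lia.
    by subst i'; apply: main => //; rewrite xc.
  have yc : (pos y i < c)%N.
    rewrite ltnNge; apply: contra nup => yc; apply/subsetP => z.
    by rewrite in_set2 => /orP[]/eqP ->; apply: up.
  have ii : i' = i.
    by apply/eqP; apply: contraT => ii; have := xyE i; rewrite eq_sym ii; lia.
  subst i'; have -> : [set x; y] = [set y; x] by apply: setUC.
  apply: main => //; rewrite ?yc //.
    by rewrite adj_sym.
  by move=> j /xyE.
move=> f f' [k g] _ _ [x [y [-> xi yi xy]]] [x' [y' [-> xi' yi' xy']]].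
have -> : x = x'.
  apply: pos_inj => j; have [->|ji] := eqVneq j i; first by rewrite xi xi'.
  by have [-> _] := xy j ji; have [-> _] := xy' j ji.
congr [set _; _]; apply: pos_inj => j; have [->|ji] := eqVneq j i.
  by rewrite yi yi'.
by have [_ ->] := xy j ji; have [_ ->] := xy' j ji.
Qed.

Lemma box_edges_singleton a s : (forall i, s i <= 1)%N -> box_edges a s = set0.
Proof.
move=> s1; apply/eqP; rewrite -subset0; apply/subsetP => f; rewrite inE.
case/andP=> /edgesP[x [y [exy ->]]] /subsetP H; exfalso.
have E z : z \in subbox a s -> forall i, pos z i = a i.
  by rewrite inE => /forallP Hz i; have := Hz i; have := s1 i; lia.
have /E hx : x \in subbox a s by apply: H; rewrite !inE eqxx.
have /E hy : y \in subbox a s by apply: H; rewrite !inE eqxx orbT.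
by have [i [+ _]] := e_pos exy; rewrite hx hy adj_irr.
Qed.

Variables (R : realType) (beta : R) (q' : nat).
Hypothesis beta0 : 0 < beta.

Definition box_gap a s (k : R) : Prop :=
  es_gap beta q' (box_edges a s) (expR (- (beta * k))).

Lemma box_gap_weaken a s k k' : k <= k' -> box_gap a s k -> box_gap a s k'.
Proof.
move=> kk' H; refine (es_gap_weaken beta0 _ H).
by rewrite ler_expR lerN2 ler_pM2l.
Qed.

Lemma box_gap_cut a s i c k : (a i < c < a i + s i)%N ->
  box_gap a (upd s i (c - a i)) k ->
  box_gap (upd a i c) (upd s i (a i + s i - c)) k ->
  box_gap a s (k + cutwidth%:R * (\prod_j upd s i 1 j)%:R).
Proof.
move=> ci Glo Gup.
pose lo := subbox a (upd s i (c - a i)).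
pose up := subbox (upd a i c) (upd s i (a i + s i - c)).
pose D := [set f in box_edges a s | ~~ (f \subset lo) && ~~ (f \subset up)].
have lo_sub : lo \subset subbox a s.
  apply/subsetP => x; rewrite !inE => /forallP H; apply/forallP => j.
  have := H j; rewrite /upd; case: eqP => [->|_] //; lia.
have up_sub : up \subset subbox a s.
  apply/subsetP => x; rewrite !inE => /forallP H; apply/forallP => j.
  have := H j; rewrite /upd; case: eqP => [->|_] //; lia.
have dis x : x \in lo -> x \in up -> False.
  rewrite !inE => /forallP/(_ i) H1 /forallP/(_ i) H2.
  by move: H1 H2; rewrite /upd eqxx; lia.
have FDE f : (f \in box_edges a s :\: D) =
    (f \in edges e) && ((f \subset lo) || (f \subset up)).
  rewrite !inE; case fe : (f \in edges e) => //=.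
  have [fb|/negbTE nfb] := boolP (f \subset subbox a s).
    by rewrite andbT -negb_or negbK.
  rewrite andbF; apply/esym/negbTE/negP => /orP[]fl.
    by rewrite (subset_trans fl lo_sub) in nfb.
  by rewrite (subset_trans fl up_sub) in nfb.
have ne f : f \in edges e -> exists x, x \in f.
  by case/edgesP => x [y [_ ->]]; exists x; rewrite !inE eqxx.
have G : es_gap beta q' (box_edges a s :\: D) (expR (- (beta * k))).
  apply: (es_gap_separated beta0 (W := lo)); first exact: expR_ge0.
  - move=> f; rewrite FDE => /andP[_ /orP[]fl]; [by left|right].
    apply/subsetP => x /(subsetP fl) xu; rewrite inE; apply/negP => xl.
    exact: dis xl xu.
  - rewrite (_ : [set f in _ | _] = box_edges a (upd s i (c - a i))) //.
    apply/setP => f; rewrite [LHS]inE FDE [RHS]inE -/lo.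
    by case: (f \subset lo); rewrite ?andbF ?andbT.
  - rewrite (_ : [set f in _ | _] = box_edges (upd a i c) (upd s i (a i + s i - c))) //.
    apply/setP => f; rewrite [LHS]inE FDE [RHS]inE -/up.
    case fe : (f \in edges e) => //=; have [x xf] := ne f fe.
    case fl : (f \subset lo); rewrite /= ?andbT ?andbF //.
    apply/esym/negP => fu; apply: (dis x); first exact: (subsetP fl).
    exact: (subsetP fu).
refine (es_gap_weaken beta0 _ (es_gap_delete beta0 (expR_ge0 _) G)).
rewrite expR_pow -expRD ler_expR -opprD lerN2 -mulrDr ler_pM2l // [leLHS]addrC lerD2l.
by rewrite -natrM ler_nat subbox_cut_card.
Qed.

(* A cut in a direction of length [s i > m] costs at most [(\prod s) / m] edges
   and shrinks the volume by a factor 2/3, so the costs form a geometric series. *)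
Lemma box_gap_reduce (m : nat) (k : R) : (0 < m)%N ->
  (forall a s, (forall i, 0 < s i <= m)%N -> box_gap a s k) ->
  forall a s, (forall i, 0 < s i)%N ->
  box_gap a s (3 * cutwidth%:R * (\prod_i s i)%:R / m%:R + k).
Proof.
move=> m0 Hk a s; have [N] := ubnP (\prod_i s i)%N.
elim: N a s => // N IH a s sN s0.
have [/forallP small|] := boolP [forall i, s i <= m]%N.
  apply: box_gap_weaken (Hk a s _); last by move=> i; rewrite s0 small.
  by rewrite lerDr divr_ge0 ?ler0n // mulr_ge0 // mulr_ge0.
rewrite negb_forall => /existsP[i]; rewrite -ltnNge => mi.
set h := uphalf (s i); set P := (\prod_j upd s i 1 j)%N.
have hs : (h < s i)%N by rewrite /h; lia.
have h0 : (0 < h)%N by rewrite /h; lia.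
have PE b : (\prod_j upd s i b j = P * b)%N by apply: prod_upd.
have sE : (\prod_j s j = P * s i)%N.
  by rewrite -PE; apply: eq_bigr => j _; rewrite /upd; case: eqP => // ->.
have P0 : (0 < P)%N.
  by rewrite prodn_gt0 // => j; rewrite /upd; case: eqP.
have upd0 b : (0 < b)%N -> forall j, (0 < upd s i b j)%N.
  by move=> b0 j; rewrite /upd; case: eqP.
have step b : (0 < b <= h)%N -> forall a', box_gap a' (upd s i b)
    (3 * cutwidth%:R * (P * h)%:R / m%:R + k).
  case/andP=> b0 bh a'; apply: box_gap_weaken (IH _ _ _ (upd0 b b0)).
    rewrite lerD2r ler_pM2r ?invr_gt0 ?ltr0n // ler_wpM2l ?mulr_ge0 //.
    by rewrite PE ler_nat leq_mul2l bh orbT.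
  rewrite PE; apply: (@leq_trans (P * s i)); last by rewrite -sE -ltnS.
  by rewrite ltn_mul2l P0 /=; lia.
have G := @box_gap_cut a s i (a i + h)%N (3 * cutwidth%:R * (P * h)%:R / m%:R + k).
apply: box_gap_weaken (G _ _ _); last 3 first.
- by rewrite ltn_add2l hs -{1}[a i]addn0 ltn_add2l h0.
- by rewrite addKn; apply: step; rewrite h0 leqnn.
- by apply: step; rewrite /h; lia.
rewrite -/P addrAC lerD2r sE !natrM.
have m0' : 0 < m%:R :> R by rewrite ltr0n.
rewrite -[X in _ + X](mulfK (lt0r_neq0 m0')) -mulrDl ler_pM2r ?invr_gt0 //.
have -> : 3 * cutwidth%:R * (P%:R * h%:R) + cutwidth%:R * P%:R * m%:R =
  cutwidth%:R * P%:R * (3 * h + m)%:R :> R by rewrite natrD natrM; ring.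
have -> : 3 * cutwidth%:R * (P%:R * (s i)%:R) =
  cutwidth%:R * P%:R * (3 * s i)%:R :> R by rewrite natrM; ring.
(* [3 * h + m <= 3 * s i], since [m < s i] and three times the smaller half is at least
   [s i - 1]. *)
rewrite ler_wpM2l ?mulr_ge0 // ler_nat /h; lia.
Qed.

(** Going from [m] to its upper half [m'] costs 3 * 2 units of [cutwidth * m ^ d.-1], as
    [m <= 2 * m']. The recursive cost shrinks by 2/3, because [3 * m' <= 2 * m] and [d.-1 >= 1].
    Then [6 + 2/3 * 18 = 18]. *)
Lemma box_gap_small (m : nat) a s : (1 < d)%N -> (0 < m)%N ->
  (forall i, 0 < s i <= m)%N -> box_gap a s (18 * cutwidth%:R * (m ^ d.-1)%:R).
Proof.
move=> d1; elim/ltn_ind: m a s => m IH a s m0 sm.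
have [m1|m1] := leqP m 1.
  rewrite /box_gap box_edges_singleton; last by move=> i; have := sm i; lia.
  refine (es_gap_weaken beta0 _ (es_gap_set0 beta0)).
  by rewrite -expR0 ler_expR oppr_le0 !mulr_ge0 // ltW.
set m' := uphalf m.
have m'0 : (0 < m')%N by rewrite /m'; lia.
have m'm : (m' < m)%N by rewrite /m'; lia.
apply: box_gap_weaken (box_gap_reduce m'0 _ a _); last 2 first.
- by move=> a' s' H; apply: (IH m').
- by move=> i; have := sm i; lia.
have sp : (\prod_i s i <= m ^ d)%N.
  rewrite -[d in (m ^ d)%N]card_ord -prod_nat_const; apply: leq_prod => i _.
  by have := sm i; lia.
have h1 : ((\prod_i s i)%:R / m'%:R : R) <= 2 * (m ^ d.-1)%:R.
  rewrite ler_pdivrMr ?ltr0n // -natrM -natrM ler_nat.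
  apply: leq_trans sp _; rewrite -{1}(ltn_predK d1) expnS.
  rewrite mulnAC leq_mul2r; apply/orP; right; rewrite /m'; lia.
have h2 : ((m' ^ d.-1)%:R : R) <= 2 / 3 * (m ^ d.-1)%:R.
  have -> : d.-1 = d.-2.+1 by lia.
  rewrite !expnS; have : (3 * (m' * m' ^ d.-2) <= 2 * (m * m ^ d.-2))%N.
    rewrite !mulnA; apply: leq_mul; first by rewrite /m'; lia.
    by case: (d.-2) => // k; rewrite leq_exp2r // ltnW.
  by rewrite -(ler_nat R) !natrM; lra.
have c0 : 0 <= cutwidth%:R :> R by [].
have := ler_wpM2l c0 h1; have := ler_wpM2l c0 h2; rewrite -mulrA.
lra.
Qed.

End Grid.

Section PathForest.
Variable V : finType.

Lemma forest_path (h : V -> nat) (F : {set {set V}}) : injective h ->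
  (forall f, f \in F -> exists x y, f = [set x; y] /\ h y = (h x).+1) -> forest F.
Proof.
move=> h_inj HF f fF; have [x [y [fE hy]]] := HF f fF.
exists x, y, [set z | (h z <= h x)%N]; rewrite !inE hy ltnn leqnn.
split=> // g; rewrite in_setD1 => /andP[gf gF]; have [x' [y' [gE hy']]] := HF g gF.
have [le|lt] := leqP (h y') (h x).
  left; rewrite gE; apply/subsetP => z; rewrite in_set2 inE => /orP[]/eqP -> //; lia.
have [lt'|le'] := ltnP (h x) (h x').
  right; rewrite gE; apply/subsetP => z; rewrite in_set2 !inE => /orP[]/eqP ->; lia.
case/eqP: gf; rewrite gE fE; have xx : x' = x by apply: h_inj; lia.
by congr [set _; _] => //; apply: h_inj; rewrite hy hy' xx.
Qed.

Lemma degree_le_card (e : rel V) v : irreflexive e ->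
  (#|[set y | e v y]| <= #|V|.-1)%N.
Proof.
move=> irr; rewrite -(cardsC1 v); apply/subset_leq_card/subsetP => y.
by rewrite !inE; apply: contraTneq => ->; rewrite irr.
Qed.

End PathForest.

Section UpSteps.
Variables (V : finType) (e : rel V) (d : nat) (pos : V -> 'I_d -> nat) (up : rel nat).
Hypothesis pos_inj : forall x y, pos x =1 pos y -> x = y.
Hypothesis up_fun : forall a b b', up a b -> up a b' -> b = b'.
Hypothesis up_inj : forall a a' b, up a b -> up a' b -> a = a'.

(** The condition [a != b] discards the step from 0 to itself on a cycle of length 1. *)
Definition up_adj : rel nat := fun a b => (a != b) && (up a b || up b a).

Lemma up_adj_sym : symmetric up_adj.
Proof. by move=> a b; rewrite /up_adj eq_sym orbC. Qed.

Lemma up_adj_irr : irreflexive up_adj.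
Proof. by move=> a; rewrite /up_adj eqxx. Qed.

Hypothesis e_pos : forall x y, e x y -> exists i,
  up_adj (pos x i) (pos y i) /\ forall j, j != i -> pos x j = pos y j.

Lemma up_degree_le v : (#|[set y | e v y]| <= d * 2)%N.
Proof.
have <- : #|{: 'I_d * bool}| = (d * 2)%N by rewrite card_prod card_ord card_bool.
apply: (card_le_functional (r := fun y (k : 'I_d * bool) =>
  (if k.2 then up (pos v k.1) (pos y k.1) else up (pos y k.1) (pos v k.1)) /\
  forall j, j != k.1 -> pos v j = pos y j)).
  move=> y; rewrite inE => /e_pos[i [/andP[_ /orP[]u] H]]; first by exists (i, true).
  by exists (i, false).
move=> y y' [i b] _ _ /= [u H] [u' H']; apply: pos_inj => j.
have [->|ji] := eqVneq j i; last by rewrite -H // -H'.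
by case: b u u' => u u'; [apply: up_fun u u'|apply: up_inj u u'].
Qed.

Lemma up_edges_le : (#|edges e| <= d * #|V|)%N.
Proof.
have <- : #|{: 'I_d * V}| = (d * #|V|)%N by rewrite card_prod card_ord.
apply: (card_le_functional (r := fun f (k : 'I_d * V) => exists y,
  [/\ f = [set k.2; y], up (pos k.2 k.1) (pos y k.1)
    & forall j, j != k.1 -> pos k.2 j = pos y j])).
  move=> f /edgesP[x [y [/e_pos[i [/andP[_ /orP[]u] H]] ->]]].
    by exists (i, x), y.
  by exists (i, y), x; split => //=; [rewrite setUC|move=> j /H].
move=> f f' [i x] _ _ /= [y [-> u H]] [y' [-> u' H']].
congr [set _; _]; apply: pos_inj => j; have [->|ji] := eqVneq j i.
  exact: up_fun u u'.
by rewrite -H // -H'.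
Qed.

End UpSteps.

(** * Trees: bridges, small depth, small degree *)

Section TreeFacts.
Variables (V : finType) (e : rel V) (root : V).
Hypothesis tree : is_tree e.

Let sym : symmetric e. Proof. by case: tree. Qed.
Let irr : irreflexive e. Proof. by case: tree. Qed.
Let conn x y : connect e x y. Proof. by case: tree. Qed.

(** [W] is what [x] reaches without using [f]. If it contained [y], a simple path closed up by [f]
    would be a cycle: with one vertex it is a loop, with two its edge is [f] itself, with more it
    contradicts acyclicity. *)
Lemma tree_forest : forest (edges e).
Proof.
move=> f /edgesP[x [y [exy fE]]].
pose e' := [rel a b | e a b && ([set a; b] != f)].
exists x, y, [set z | connect e' x z]; rewrite !inE connect0; split=> //.
  apply/negP => /connectP[p0 p0e yE].
  case: (shortenP p0e) yE => p pe pu _ yE.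
  have pe0 : path e x p by apply: sub_path pe => a b /= /andP[].
  have : ucycle e (x :: p) by apply/andP; split; rewrite //= rcons_path pe0 -yE sym exy.
  case: tree => _ _ _ acyc /acyc; case: p pe pu yE {pe0} => [_ _ xy|a [|b p]] //=.
    by move: exy; rewrite xy irr.
  by move=> + _ ya; rewrite -ya -fE eqxx andbF.
move=> g; rewrite in_setD1 => /andP[gf /edgesP[a [b [eab gE]]]].
have ab : connect e' a b by apply: connect1; rewrite /= eab -gE.
have ba : connect e' b a by apply: connect1; rewrite /= sym eab setUC -gE.
have [ha|ha] := boolP (connect e' x a).
  left; rewrite gE; apply/subsetP => z; rewrite in_set2 inE => /orP[]/eqP -> //.
  exact: connect_trans ha ab.
right; rewrite gE; apply/subsetP => z; rewrite in_set2 !inE => /orP[]/eqP -> //.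
by apply: contra ha => hb; apply: connect_trans hb ba.
Qed.

Lemma graph_dist_le_depth x : (graph_dist e root x <= depth e root)%N.
Proof. exact: (leq_bigmax (F := graph_dist e root) x). Qed.

Lemma depth_le1 : (1 < #|V|)%N -> (depth e root <= 1)%N ->
  forall x, x = root \/ (e root x /\ depth e root = 1%N).
Proof.
move=> V1 D1 x; have := leq_trans (graph_dist_le_depth x) D1.
have := graph_dist_le_depth x.
rewrite /graph_dist; set P := fun k : nat => _; set k := find P _ => kD k1.
(* As [k <= 1 < #|V|], the search succeeded and [k] is a true distance, not the default value. *)
have kV : (k < size (iota 0 #|V|))%N by rewrite size_iota; lia.
have := nth_find 0%N (etrans (has_find _ _) kV).
rewrite -/k nth_iota; last by move: kV; rewrite size_iota.
rewrite add0n; case: k kD k1 {kV} => [|[|k]] // kD _ /existsP[p /andP[]].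
  by rewrite tuple0 /= => _ /eqP ->; left.
case: p => [[|a [|b p]]] //= _; rewrite andbT => ea /eqP <-; right; split=> //.
by apply/eqP; rewrite eqn_leq D1.
Qed.

Lemma exists_neighbour x : (1 < #|V|)%N -> exists y, e x y.
Proof.
move=> V1; have : (0 < #|[set~ x]|)%N by rewrite cardsC1; lia.
case/card_gt0P => z; rewrite !inE => zx.
have /connectP[[|y p] /=] := conn x z; first by move=> _ E; rewrite E eqxx in zx.
by case/andP=> exy _ _; exists y.
Qed.

Lemma degree_le_max x : (#|[set y | e x y]| <= max_degree e)%N.
Proof. exact: (leq_bigmax (F := fun x => #|[set y | e x y]|) x). Qed.

Lemma max_degree_gt0 : (1 < #|V|)%N -> (0 < max_degree e)%N.
Proof.
move=> V1; have [y ey] := exists_neighbour root V1.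
apply: leq_trans (degree_le_max root); apply/card_gt0P; exists y.
by rewrite inE.
Qed.

(** With degrees at most 1, the root and its neighbour are closed under adjacency, so connectedness
    leaves only two vertices. *)
Lemma max_degree_gt1 : (2 < #|V|)%N -> (1 < max_degree e)%N.
Proof.
move=> V2; rewrite ltnNge; apply/negP => D1.
have uniq1 x y z : e x y -> e x z -> y = z.
  move=> exy exz; have /card_le1_eqP := leq_trans (degree_le_max x) D1.
  by apply; rewrite inE.
have [a ra] : exists y, e root y by apply: exists_neighbour; lia.
have cl : fingraph.closed e (mem [set root; a]).
  apply: intro_closed; first exact: sym_connect_sym.
  move=> x y exy; rewrite !inE => /orP[]/eqP xE; rewrite xE in exy.
    by rewrite (uniq1 _ _ _ exy ra) eqxx orbT.
  by rewrite (uniq1 _ _ _ exy (_ : e a root)) ?eqxx // sym.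
have : [set: V] \subset [set root; a].
  apply/subsetP => x _; have := closed_connect cl (conn root x).
  by rewrite !inE eqxx.
by move/subset_leq_card; rewrite cardsT cards2; case: (root != a); lia.
Qed.

Lemma card_le_depth1 : (1 < #|V|)%N -> (depth e root <= 1)%N ->
  depth e root = 1%N /\ (#|V| <= (max_degree e).+1)%N.
Proof.
move=> V1 D1; have H := depth_le1 V1 D1; split.
  have : (0 < #|[set~ root]|)%N by rewrite cardsC1; lia.
  by case/card_gt0P => z; rewrite !inE => /eqP zx; case: (H z) => [|[]].
rewrite -cardsT; apply: (@leq_trans #|root |: [set y | e root y]|).
  apply/subset_leq_card/subsetP => x _; rewrite !inE.
  by case: (H x) => [->|[-> _]]; rewrite ?eqxx ?orbT.
by rewrite cardsU1 -add1n leq_add ?leq_b1 // degree_le_max.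
Qed.

End TreeFacts.

Section SmallOrLarge.
Variables (R : realType) (beta : R) (q' : nat) (V : finType) (e : rel V).
Hypothesis beta0 : 0 < beta.

(** With at most 20 vertices there are at most [20 * Delta] edges, and the Doeblin bound applies. *)
Lemma SW_mixing_time_le (kappa K D : R) (Delta : nat) :
  symmetric e -> irreflexive e -> (0 < #|V|)%N -> 0 <= D -> 0 <= kappa ->
  es_gap beta q' (edges e) (expR (- (beta * kappa))) ->
  (forall v, #|[set y | e v y]| <= Delta)%N ->
  #|edges e|%:R <= D * #|V|%:R ->
  20 * Delta%:R <= K -> kappa + 9 * Delta%:R <= K ->
  (SW_mixing_time beta q'.+1 e <=
    (expR (beta * K) * (2 + (ln 2 + D * beta) * #|V|%:R))%:E)%E.
Proof.
move=> sym irr V0 D0 kappa0 Fgap deg FD K20 K9.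
have [V20|V21] := leqP #|V| 20.
  apply: SW_mixing_time_doeblin => //; apply: le_trans K20.
  rewrite -natrM ler_nat; apply: leq_trans (card_edges_le deg) _.
  by rewrite leq_mul2r V20 orbT.
apply: (SW_mixing_time_gap beta0 irr V21 kappa0 Fgap _ FD K9) => v.
exact: card_edges_at.
Qed.

End SmallOrLarge.

Section MinSide.
Variables (d : nat) (l : 'I_d -> nat).

Lemma min_side_le i : (min_side l <= l i)%N.
Proof.
rewrite /min_side; move: (\prod_j l j)%N => D.
have : i \in index_enum 'I_d by rewrite mem_index_enum.
elim: (index_enum 'I_d) => //= j s IH; rewrite inE big_cons => /orP[/eqP <-|/IH h].
  exact: geq_minl.
by rewrite geq_min h orbT.
Qed.

Lemma min_side_gt0 : (forall i, 0 < l i)%N -> (0 < min_side l)%N.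
Proof.
move=> l0; rewrite /min_side; apply: (big_ind (fun m => 0 < m)%N) => [|x y x0 y0|i _]; last exact: l0.
  exact: prodn_gt0.
by rewrite leq_min x0.
Qed.

Lemma min_side_expn_le : (min_side l ^ d <= \prod_i l i)%N.
Proof.
rewrite -[d in (_ ^ d)%N]card_ord -prod_nat_const; apply: leq_prod => i _.
exact: min_side_le.
Qed.

End MinSide.

Section Box.
Variables (R : realType) (beta : R) (q' d : nat).
Variables (Lam : {fset {ffun 'I_d -> int}}) (l : 'I_d -> nat).
Hypotheses (beta0 : 0 < beta) (d0 : (0 < d)%N).
Hypothesis l0 : forall i, (0 < l i)%N.
Variable a : {ffun 'I_d -> int}.
Hypothesis LamE : forall x,
  (x \in Lam) = [forall i, 1 <= x i - a i <= (l i)%:Z].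

Let e : rel Lam := @box_adj d Lam.
Let pos (x : Lam) (i : 'I_d) : nat := absz (val x i - a i - 1)%R.
Let up : rel nat := fun m n => m.+1 == n.

Let LamP (x : Lam) i : 1 <= val x i - a i <= (l i)%:Z.
Proof. by have := valP x; rewrite LamE => /forallP. Qed.

Let posE (x : Lam) i : (pos x i)%:Z = val x i - a i - 1.
Proof. by rewrite /pos gez0_abs //; have := LamP x i; lia. Qed.

Let pos_inj x y : pos x =1 pos y -> x = y.
Proof.
move=> H; apply: val_inj; apply/ffunP => i; have := posE x i.
by rewrite H posE => /addIr/addIr.
Qed.

Let pos_lt x i : (pos x i < l i)%N.
Proof. by have := posE x i; have := LamP x i; lia. Qed.

Let up_fun m n n' : up m n -> up m n' -> n = n'.
Proof. by move=> /eqP <- /eqP. Qed.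
Let up_inj m m' n : up m n -> up m' n -> m = m'.
Proof. by rewrite /up; lia. Qed.

Lemma sum_absz_eq1 (I : finType) (z : I -> int) : \sum_i `|z i| = 1 ->
  exists i, `|z i|%N = 1%N /\ forall j, j != i -> z j = 0.
Proof.
move=> S; have [/forallP z0|] := boolP [forall i, z i == 0].
  by move: S; rewrite big1 // => i _; have /eqP -> := z0 i.
rewrite negb_forall => /existsP[i zi]; exists i.
move: S; rewrite (bigD1 i) //= => S.
have S0 : 0 <= \sum_(j | j != i) `|z j| by apply: sumr_ge0.
move: S S0; set T := \sum_(j | j != i) _ => S S0.
have zi0 : 0 < `|z i| by rewrite normr_gt0.
have zi1 : `|z i| = 1 by lia.
have T0 : T = 0 by lia.
split=> [|j ji]; first by apply/eqP; rewrite -eqz_nat abszE zi1.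
move: T0; rewrite /T => /eqP; rewrite psumr_eq0 // => /allP/(_ j (mem_index_enum j))/implyP/(_ ji).
by rewrite normr_eq0 => /eqP.
Qed.

Let e_pos x y : e x y -> exists i,
  up_adj up (pos x i) (pos y i) /\ forall j, j != i -> pos x j = pos y j.
Proof.
move=> /eqP/sum_absz_eq1[i [zi zj]]; exists i; split=> [|j /zj {}zj].
  have {zi} : absz (val x i - val y i)%R = 1%N := zi.
  have := posE x i; have := posE y i; rewrite /up_adj /up; lia.
have {zj} : val x j - val y j = 0 := zj.
have := posE x j; have := posE y j; lia.
Qed.

Let e_sym : symmetric e.
Proof.
move=> x y; rewrite /e /box_adj /Zd_adj; congr (_ == _).
by apply: eq_bigr => i _; rewrite distrC.
Qed.

Let e_irr : irreflexive e.
Proof.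
by move=> x; rewrite /e /box_adj /Zd_adj big1 // => i _; rewrite subrr normr0.
Qed.

Let card_Lam : #|{: Lam}| = (\prod_i l i)%N.
Proof.
apply/eqP; rewrite eqn_leq; apply/andP; split.
  rewrite -cardsT; apply: (leq_trans _ (card_subbox pos_inj (fun=> 0%N) l)).
  apply/subset_leq_card/subsetP => x _; rewrite inE; apply/forallP => i.
  exact: pos_lt.
rewrite -card_dffun_prod -cardsT.
apply: (card_le_functional (r := fun (g : {dffun forall i, 'I_(l i)}) (x : Lam) =>
  forall i, pos x i = g i)) => [g _|g g' x _ _ Hg Hg'].
  pose z : {ffun 'I_d -> int} := [ffun i => a i + 1 + (g i : nat)%:Z].
  have zL : z \in Lam.
    by rewrite LamE; apply/forallP => i; rewrite ffunE; have := ltn_ord (g i); lia.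
  exists [` zL]%fset => i; apply/eqP; rewrite -eqz_nat posE /= ffunE.
  by apply/eqP; ring.
by apply/ffunP => i; apply: val_inj; rewrite /= -Hg -Hg'.
Qed.

Let box_edgesT : box_edges e pos (fun=> 0%N) l = edges e.
Proof.
apply/setP => f; rewrite inE; case: (f \in edges e) => //=.
by apply/subsetP => x _; rewrite inE; apply/forallP => i; exact: pos_lt.
Qed.

(** With [Delta <= 2 * A], the small case needs [40 * A] and the large one [21 * A + 18 * A], where
    21 is 3 for cutting the box into pieces of side at most [m] plus 18 for those pieces. In
    dimension 1 the box is a path. *)
Lemma box_mixing_time :
  (SW_mixing_time beta q'.+1 e <=
    (expR (45 * beta * box_area R l Lam) *
      (2 + (ln 2 + d%:R * beta) * (#|` Lam|)%:R))%:E)%E.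
Proof.
have LE : #|` Lam| = #|{: Lam}| by rewrite cardfE.
have m0 := min_side_gt0 l0; set m := min_side l in m0.
pose A : R := box_area R l Lam.
have AE : A = (\prod_i l i)%:R / m%:R by rewrite /A /box_area LE card_Lam.
have N0 : (0 < \prod_i l i)%N by exact: prodn_gt0.
have mR : 0 < m%:R :> R by rewrite ltr0n.
have mA : (m ^ d.-1)%:R <= A.
  rewrite AE ler_pdivlMr // -natrM ler_nat -expnSr prednK //.
  exact: min_side_expn_le.
have A1 : 1 <= A.
  by apply: le_trans mA; rewrite ler1n expn_gt0 m0.
(* If [m = 1], then [A] is the volume, which exceeds every degree. Otherwise the degree is at most
   [2 * d <= 2 * 2 ^ d.-1 <= 2 * m ^ d.-1]. *)
have degA : (max_degree e)%:R <= 2 * A.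
  have [m1|m2] := leqP m 1.
    have -> : A = #|{: Lam}|%:R.
      by rewrite AE card_Lam (_ : m = 1%N) ?divr1 //; lia.
    apply: (@le_trans _ _ #|{: Lam}|%:R); last by have := ler0n R #|{: Lam}|; lra.
    rewrite ler_nat; apply/bigmax_leqP => x _.
    by apply: leq_trans (degree_le_card x e_irr) _; exact: leq_pred.
  apply: (@le_trans _ _ (d * 2)%:R).
    rewrite ler_nat; apply/bigmax_leqP => x _.
    exact: (up_degree_le pos_inj up_fun up_inj e_pos).
  rewrite natrM mulrC ler_pM2l //; apply: le_trans mA; rewrite ler_nat.
  apply: leq_trans (_ : 2 ^ d.-1 <= _)%N.
    by case: (d) d0 => // d' _; exact: ltn_expl.
  by case: (d.-1) => // k; rewrite leq_exp2r.
have deg v : (#|[set y | e v y]| <= max_degree e)%N by apply: degree_le_max.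
have FD : #|edges e|%:R <= d%:R * #|{: Lam}|%:R :> R.
  by rewrite -natrM ler_nat; exact: (up_edges_le pos_inj up_fun e_pos).
have K20 : 20 * (max_degree e)%:R <= 45 * A by lra.
have -> : 45 * beta * box_area R l Lam = beta * (45 * A).
  by rewrite -/A; ring.
rewrite LE.
have [d1|d1] := leqP d 1.
  apply: (SW_mixing_time_le beta0 e_sym e_irr _ _ _ _ deg FD K20 (kappa := 1)) => //.
  - by rewrite card_Lam.
  - rewrite mulr1; apply: es_gap_forest => //.
    have d1' : d = 1%N by lia.
    have i0 : 'I_d by rewrite d1'; exact: ord0.
    have iE i : i = i0.
      by apply: val_inj; have := ltn_ord i; have := ltn_ord i0; rewrite /=; lia.
    apply: (forest_path (h := fun x => pos x i0)).
      by move=> x y H; apply: pos_inj => i; rewrite (iE i).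
    move=> f /edgesP[x [y [/e_pos[i [/andP[_ /orP[]/eqP u] _]] ->]]]; rewrite (iE i) in u.
      by exists x, y.
    by exists y, x; split; rewrite 1?setUC.
  - lra.
apply: (SW_mixing_time_le beta0 e_sym e_irr _ _ _ _ deg FD K20 (kappa := 21 * A)) => //.
- by rewrite card_Lam.
- lra.
- have cut c : exists ps : seq (nat * nat), (size ps <= 1)%N /\
    forall a b, up_adj up a b -> (a < c <= b)%N -> (a, b) \in ps.
    exists [:: (c.-1, c)]; split=> // x y; rewrite /up_adj /up inE.
    by move=> xy cxy; apply/eqP; congr (_, _); lia.
  have small a' s' H := box_gap_small pos_inj (up_adj_sym up) (up_adj_irr up)
     e_pos cut (q' := q') beta0 a' (s := s') d1 m0 H.
  have := box_gap_reduce pos_inj (up_adj_sym up) e_pos cut beta0 m0 small (fun=> 0%N) l0.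
  rewrite /box_gap box_edgesT; apply: es_gap_weaken => //.
  rewrite ler_expR lerN2 ler_pM2l // !mulr1 -mulrA -AE; lra.
- lra.
Qed.

End Box.

Section Torus.
Variables (R : realType) (beta : R) (q' d L : nat).
Hypotheses (beta0 : 0 < beta) (d0 : (0 < d)%N) (L0 : (0 < L)%N).

Let V : finType := {ffun 'I_d -> 'I_L}.
Let e : rel V := @torus_adj d L.
Let pos (x : V) (i : 'I_d) : nat := x i.
Let up : rel nat := fun a b => [&& (a < L)%N, (b < L)%N & b == (a.+1 %% L)%N].

Let upE a b : up a b = (a < L)%N && (b == if a.+1 == L then 0 else a.+1)%N.
Proof.
rewrite /up; case: (ltnP a L) => //= aL; case: (a.+1 =P L) => [->|ne].
  by rewrite modnn; case: eqP => [->|]; rewrite ?andbF ?andbT.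
by rewrite modn_small; lia.
Qed.

Let pos_inj x y : pos x =1 pos y -> x = y.
Proof. by move=> H; apply/ffunP => i; apply: val_inj; apply: H. Qed.

Let up_fun a b b' : up a b -> up a b' -> b = b'.
Proof. by move=> /and3P[_ _ /eqP ->] /and3P[_ _ /eqP ->]. Qed.

Let up_inj a a' b : up a b -> up a' b -> a = a'.
Proof. by rewrite !upE; case: (a.+1 =P L); case: (a'.+1 =P L); lia. Qed.

Let e_pos x y : e x y -> exists i,
  up_adj up (pos x i) (pos y i) /\ forall j, j != i -> pos x j = pos y j.
Proof.
case/andP=> xy /existsP[i /andP[xyi /forallP H]]; exists i.
have {}H j : j != i -> x j = y j by move=> ji; have /implyP/(_ ji)/eqP := H j.
split=> [|j /H E]; last by rewrite /pos E.
have nxy : pos x i != pos y i.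
  apply: contra xy => /eqP E; apply/eqP/ffunP => j.
  by have [->|/H //] := eqVneq j i; apply: val_inj.
rewrite /up_adj nxy /=; case/orP: xyi => /eqP E; rewrite /up /pos.
  by rewrite [in X in X || _]E /= !ltn_ord ltn_mod L0 eqxx.
by apply/orP; right; rewrite E /= !ltn_ord ltn_mod L0 eqxx.
Qed.

Let e_sym : symmetric e.
Proof.
move=> x y; rewrite /e /torus_adj eq_sym; congr (_ && _).
apply: eq_existsb => i; rewrite orbC; congr (_ && _).
by apply: eq_forallb => j; rewrite [x j == _]eq_sym.
Qed.

Let e_irr : irreflexive e.
Proof. by move=> x; rewrite /e /torus_adj eqxx. Qed.

Let card_V : #|V| = (L ^ d)%N.
Proof. by rewrite card_ffun !card_ord. Qed.

Let cut c : exists ps : seq (nat * nat), (size ps <= 2)%N /\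
  forall a b, up_adj up a b -> (a < c <= b)%N -> (a, b) \in ps.
Proof.
(* Only the step at the cut and the wrap-around edge cross it. *)
exists [:: (c.-1, c); (0, L.-1)]%N; split=> // a b; rewrite /up_adj !upE !inE !xpair_eqE.
by case: (a.+1 =P L); case: (b.+1 =P L); lia.
Qed.

(** Removing the edge that closes the cycle leaves a path: one unit for the deletion, one for the
    forest. *)
Lemma torus_gap1 : d = 1%N -> es_gap beta q' (edges e) (expR (- (beta * 2))).
Proof.
move=> d1; have i0 : 'I_d by rewrite d1; exact: ord0.
have iE i : i = i0.
  by apply: val_inj; have := ltn_ord i; have := ltn_ord i0; rewrite /=; lia.
pose D := [set f in edges e | [exists x, [exists y,
  [&& f == [set x; y], pos x i0 == 0 & pos y i0 == L.-1]]]]%N.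
have pi x y : pos x i0 = pos y i0 -> x = y.
  by move=> H; apply: pos_inj => i; rewrite (iE i).
have D1 : (#|D| <= 1)%N.
  rewrite -card_unit; apply: (card_le_functional (r := fun f (_ : unit) =>
    exists x y, [/\ f = [set x; y], pos x i0 = 0%N & pos y i0 = L.-1])).
    move=> f; rewrite inE => /andP[_ /existsP[x /existsP[y /and3P[/eqP fE /eqP x0 /eqP yL]]]].
    by exists tt, x, y.
  move=> f f' _ _ _ [x [y [-> x0 yL]]] [x' [y' [-> x0' yL']]].
  by congr [set _; _]; apply: pi; congruence.
have Fo : forest (edges e :\: D).
  apply: (forest_path (h := fun x => pos x i0)) => // f.
  rewrite in_setD inE => /andP[nD fe]; rewrite fe /= in nD.
  have nD' x y : f = [set x; y] -> pos x i0 = 0%N -> pos y i0 = L.-1 -> False.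
    move=> fE x0 yL; case/negP: nD; apply/existsP; exists x; apply/existsP; exists y.
    by rewrite fE x0 yL !eqxx.
  case/edgesP: fe => x [y [/e_pos[i [ui _]] fE]]; rewrite (iE i) in ui.
  have fE' : f = [set y; x] by rewrite setUC.
  have := nD' x y fE; have := nD' y x fE'; move: ui; rewrite /up_adj !upE => ui N1 N2.
  have [xy|yx] : pos y i0 = (pos x i0).+1 \/ pos x i0 = (pos y i0).+1.
    by move: ui; case: ((pos x i0).+1 =P L); case: ((pos y i0).+1 =P L); lia.
    by exists x, y.
  by exists y, x.
have G := es_gap_delete beta0 (expR_ge0 _) (es_gap_forest (q' := q') beta0 Fo).
refine (es_gap_weaken beta0 _ G).
rewrite expR_pow -expRD ler_expR.
have D1R : #|D|%:R <= 1 :> R by rewrite lern1.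
by have := ler_wpM2l (ltW beta0) D1R; lra.
Qed.

(** The sides are already equal, so [box_gap_small] applies directly with [cutwidth] 2:
    [36 * A + 18 * A] in the large case, [40 * A] in the small one. *)
Lemma torus_mixing_time :
  (SW_mixing_time beta q'.+1 e <=
    (expR (75 * beta * (L ^ d.-1)%N%:R) *
      (2 + (ln 2 + d%:R * beta) * (L ^ d)%N%:R))%:E)%E.
Proof.
pose A : R := (L ^ d.-1)%:R.
have A1 : 1 <= A by rewrite ler1n expn_gt0 L0.
have degA : (max_degree e)%:R <= 2 * A.
  have [L1|L2] := leqP L 1.
    apply: (@le_trans _ _ 0); last by lra.
    rewrite (_ : 0 = 0%:R) // ler_nat; apply/bigmax_leqP => x _.
    apply: leq_trans (degree_le_card x e_irr) _; rewrite card_V.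
    have E1 : L = 1%N by lia.
    by rewrite E1 exp1n.
  apply: (@le_trans _ _ (d * 2)%:R).
    rewrite ler_nat; apply/bigmax_leqP => x _.
    exact: (up_degree_le pos_inj up_fun up_inj e_pos).
  rewrite natrM mulrC ler_pM2l // ler_nat.
  apply: leq_trans (_ : 2 ^ d.-1 <= _)%N.
    by case: (d) d0 => // d' _; exact: ltn_expl.
  by case: (d.-1) => // k; rewrite leq_exp2r.
have deg v : (#|[set y | e v y]| <= max_degree e)%N by apply: degree_le_max.
have FD : #|edges e|%:R <= d%:R * #|V|%:R :> R.
  by rewrite -natrM ler_nat; exact: (up_edges_le pos_inj up_fun e_pos).
have K20 : 20 * (max_degree e)%:R <= 75 * A by lra.
have -> : 75 * beta * (L ^ d.-1)%N%:R = beta * (75 * A) by rewrite -/A; ring.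
rewrite -card_V.
have V0 : (0 < #|V|)%N by rewrite card_V expn_gt0 L0.
have [d1|d1] := leqP d 1.
  apply: (SW_mixing_time_le beta0 e_sym e_irr V0 _ _ _ deg FD K20 (kappa := 2)) => //.
    by apply: torus_gap1; lia.
  lra.
apply: (SW_mixing_time_le beta0 e_sym e_irr V0 _ _ _ deg FD K20 (kappa := 36 * A)) => //.
- by rewrite mulr_ge0.
- have := box_gap_small pos_inj (up_adj_sym up) (up_adj_irr up)
     e_pos cut (q' := q') beta0 (fun=> 0%N) (s := fun=> L) d1 L0 _.
  rewrite /box_gap (_ : box_edges e pos (fun=> 0%N) (fun=> L) = edges e); last first.
    apply/setP => f; rewrite inE; case: (f \in edges e) => //=.
    apply/subsetP => x _; rewrite inE; apply/forallP => i.
    by rewrite add0n /=; exact: ltn_ord.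
  move=> H; have {}H := H (fun i => _); refine (es_gap_weaken beta0 _ (H _)).
    rewrite ler_expR lerN2 ler_pM2l // -/A; lra.
  by rewrite L0 leqnn.
- lra.
Qed.

End Torus.

Section Tree.
Variables (R : realType) (beta : R) (q' : nat) (V : finType) (e : rel V) (root : V).
Variable c : R.
Hypotheses (beta0 : 0 < beta) (tree : is_tree e).
Hypothesis hdepth : (depth e root)%:R = c * ln #|V|%:R.

(** By [hdepth] the power of [n] is [expR (beta * 5 * h * Delta)]. For [h >= 2] and [n >= 21] the
    gap suffices, as [1 + 9 * Delta <= 10 * Delta]. Otherwise there are at most [5 * h * Delta]
    edges: a tree of depth 1 is a star with [n <= Delta + 1], and for [h >= 2] and [3 <= n <= 20]
    one has [Delta >= 2]. *)
Lemma tree_mixing_time :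
  (SW_mixing_time beta q'.+1 e <=
    (powR #|V|%:R (5 * c * beta * (max_degree e)%:R) *
      (2 + (ln 2 + beta) * #|V|%:R))%:E)%E.
Proof.
have [sym irr _ _] := tree.
have V0 : (0 < #|V|)%N by apply/card_gt0P; exists root.
set Delta := max_degree e; set h := depth e root.
have -> : powR #|V|%:R (5 * c * beta * Delta%:R) =
    expR (beta * (5 * h * Delta)%:R) :> R.
  rewrite /powR gt_eqF ?ltr0n //; congr expR.
  by rewrite natrM natrM hdepth; ring.
have -> : ln 2 + beta = ln 2 + 1 * beta by rewrite mul1r.
have FV := card_forest R (tree_forest tree).
have deg v : (#|[set y | e v y]| <= Delta)%N by apply: degree_le_max.
have small : (#|edges e| <= 5 * h * Delta)%N ->
    (SW_mixing_time beta q'.+1 e <=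
    (expR (beta * (5 * h * Delta)%:R) * (2 + (ln 2 + 1 * beta) * #|V|%:R))%:E)%E.
  by move=> H; apply: SW_mixing_time_doeblin; rewrite ?ler_nat.
have [V1|V1] := leqP #|V| 1.
  apply: small; apply: leq_trans (card_edges_le (Delta := 0) _) _; last by rewrite muln0.
  by move=> v; apply: leq_trans (degree_le_card v irr) _; lia.
have D0 : (0 < Delta)%N := max_degree_gt0 root tree V1.
have [h1|h2] := leqP h 1.
  have [hE VD] := card_le_depth1 V1 h1.
  apply: small; apply: leq_trans FV _; rewrite /h hE; move: VD; rewrite -/Delta; lia.
have [V20|V21] := leqP #|V| 20.
  have [V2|V2] := leqP #|V| 2.
    by apply: small; apply: leq_trans FV _; nia.
  have D1 : (1 < Delta)%N := max_degree_gt1 root tree V2.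
  apply: small; apply: leq_trans FV _; nia.
apply: (SW_mixing_time_gap beta0 irr V21 ler01 _ (Delta := Delta)).
- rewrite mulr1; apply: es_gap_forest => //; exact: tree_forest.
- by move=> v; apply: card_edges_at.
- by rewrite mul1r ler_nat.
- rewrite -[9]/(9%:R) -natrM -[1]/(1%:R) -natrD ler_nat; nia.
Qed.

End Tree.

Theorem corollary3p2 (R : realType) (beta : R) (q d : nat)
    (Lam : {fset {ffun 'I_d -> int}}) (l : 'I_d -> nat)
    (L : nat)
    (n : nat) (V : finType) (e : rel V) (root : V) (c : R)
    (hbeta : 0 < beta) (hq : (0 < q)%N) (hd : (0 < d)%N)
    (hLam : rectilinear l Lam)
    (hL : (0 < L)%N)
    (htree : is_tree e) (hn : #|V| = n)
    (hdepth : (depth e root)%:R = c * ln (n%:R : R)) :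
  [/\ (SW_mixing_time beta q (@box_adj d Lam)
        <= (expR (45 * beta * box_area R l Lam) *
            (2 + (ln 2 + d%:R * beta) * (#|` Lam|)%:R))%:E)%E,
      (SW_mixing_time beta q (@torus_adj d L)
        <= (expR (75 * beta * (L ^ d.-1)%N%:R) *
            (2 + (ln 2 + d%:R * beta) * (L ^ d)%N%:R))%:E)%E
    & (SW_mixing_time beta q e
        <= (powR n%:R (5 * c * beta * (max_degree e)%:R) *
            (2 + (ln 2 + beta) * n%:R))%:E)%E].
Proof.
case: q hq => // q' _; subst n; split.
- have [l0 [a LamE]] := hLam; exact: box_mixing_time LamE.
- exact: torus_mixing_time.
- exact: tree_mixing_time hdepth.
Qed.
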